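(* Let $W$ be a finite complex reflection group, $\mathcal{L}$ an admissible lattice for $W$, and $\mathbf{k}$ a commutative $R$-algebra. For every $W$-orbit $X\in\mathcal{L}/W$ choose a representative $x_*\in X$. Then there exists an isomorphism of $\mathbf{k}$-algebras $$\mathcal{C}_{\mathbf{k}}(W,\mathcal{L})\simeq\bigoplus_{X\in\mathcal{L}/W}\mathrm{Mat}_X(\mathbf{k}\tilde{H}_{x_*}),$$ where $\mathrm{Mat}_X(A)$ is the algebra of matrices over $A$ with rows and columns indexed by the finite set $X$.
   Context: Reflection groups and braid groups: $W\subset \mathrm{GL}_n(\mathbf{C})$ is a finite group generated by (pseudo-)reflections, $\mathcal{A}$ is the set of its reflecting hyperplanes, $m_H$ is the order of the cyclic subgroup of $W$ fixing $H\in\mathcal{A}$ pointwise. The distinguished reflection of $H$ is the element $s$ of this subgroup with non-trivial eigenvalue $\exp(2\pi \mathrm{i}/m_H)$. Let $B=\pi_1((\mathbf{C}^n\setminus\bigcup\mathcal{A})/W,x_0)$ be the braid group (with $x_0\in\mathbf{C}^n\setminus\bigcup\mathcal{A}$ a chosen base point), with natural projection $\pi:B\to W$. A braided reflection around $H$ is the class in $B$ of a path in $\mathbf{C}^n\setminus\bigcup\mathcal{A}$ from $x_0$ to $s(x_0)$ of the form: a path $\gamma$ from $x_0$ to a point close to a generic point of $H$, then a rotation around $H$ by angle $2\pi/m_H$ (in the positive direction), then $s(\gamma)^{-1}$; here $s$ is the distinguished reflection of $H$, and $\pi(\sigma)=s$. Parameters: $R=\mathbf{Z}[a_{H,i},a_{H,0}^{\pm1}]$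 with $H\in\mathcal{A}$, $0\le i<m_H$, is the Laurent polynomial ring with the convention $a_{H,i}=a_{w(H),i}$ for all $w\in W$. Admissible lattices: a reflection subgroup $W_0$ of $W$ is full if for every reflection in $W_0$ all reflections of $W$ with the same hyperplane are in $W_0$. A full reflection subgroup is identified with its set of reflecting hyperplanes (so $H\in x$ makes sense for $x\in\mathcal{L}$). An admissible (semi-)lattice $\mathcal{L}$ is a set of full reflection subgroups of $W$, ordered by inclusion, such that any two elements $\lambda,\mu$ have a least upper bound $\lambda\vee\mu$ in $\mathcal{L}$, $\mathcal{L}$ is stable under the conjugation action of $W$, and $\mathcal{L}$ contains the trivial subgroup and all the full cyclic reflection subgroups $\{H\}$, $H\in\mathcal{A}$. Algebras: for a commutative $R$-algebra $\mathbf{k}$, $\mathbf{k}\mathcal{L}$ is the free $\mathbf{k}$-module with basis $e_\lambda$ ($\lambda\in\mathcal{L}$) and product $e_\lambda e_\mu=e_{\lambda\vee\mu}$; $e_H:=e_{\{H\}}$. The group $B$ acts on it through $W$, and $\mathbf{k}B\ltimes\mathbf{k}\mathcal{L}$ is the semidirect product ($b e_\lambda b^{-1}=e_{\pi(b)(\lambda)}$). $\mathcal{C}_{\mathbf{k}}(W,\mathcal{L})$ is the quotient of $\mathbf{k}B\ltimes\mathbf{k}\mathcal{L}$ by the two-sided ideal generated by all $\sigma^{m_H}-1-Q_s(\sigma)e_H$, where $\sigma$ runs over the braided reflections of $B$, $s=\pi(\sigma)$, $H=\mathrm{Ker}(s-1)$, $Q_s(X)=\sum_{k=0}^{m_H-1}a_{H,k}X^k-1$.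 Generalized Hecke algebras: for $x\in\mathcal{L}$ let $G_x<W$ be the stabilizer of $x$, $\hat{B}_x=\pi^{-1}(G_x)\subset B$, and $R_x=\mathbf{Z}[a_{H,i},a_{H,0}^{\pm1}]\subset R$ with $H$ running over $x$. $\tilde{H}_x$ is the quotient of $R_x\hat{B}_x$ by the two-sided ideal generated by the elements $\sigma^{m_H}-\sum_{i=0}^{m_H-1}a_{H,i}\sigma^i$ for $\sigma$ a braided reflection of $B$ around some $H\in x$, and the elements $\sigma^{m_H}-1$ for $\sigma$ a braided reflection of $B$ around some $H\in\mathcal{A}\setminus x$ (all these elements do lie in $R_x\hat{B}_x$). Finally $\mathbf{k}\tilde{H}_x=\tilde{H}_x\otimes_{R_x}\mathbf{k}$. *)

(* Defs.v *)
From HB Require Import structures.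
From mathcomp Require Import all_boot all_order all_algebra all_fingroup all_solvable all_character.
From mathcomp Require Import finmap.
From mathcomp Require Import complex lra zify.
From mathcomp Require Import all_classical all_reals all_analysis homotopy.

Set Implicit Arguments.
Unset Strict Implicit.
Unset Printing Implicit Defensive.

Import Order.TTheory GRing.Theory Num.Theory.
Import numFieldNormedType.Exports.

Local Open Scope classical_set_scope.
Local Open Scope ring_scope.
Local Open Scope quotient_scope.

(* MathComp's algType excludes the zero ring; here a k-algebra is a ring, possibly
   zero, with a ring morphism from k to its centre. *)
HB.mixin Record isAlgOver (k : comPzRingType) A & GRing.PzRing A := {
  alg_of : k -> A;
  alg_ofD : {morph alg_of : c d / c + d};
  alg_ofM : {morph alg_of : c d / c * d};
  alg_of1 : alg_of 1 = 1;
  alg_ofC : forall c a, alg_of c * a = a * alg_of c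
}.

#[short(type="algOver")]
HB.structure Definition AlgOver (k : comPzRingType) :=
  {A of isAlgOver k A & GRing.PzRing A}.

Definition alg_isomorphic (k : comPzRingType) (A B : algOver k) : Prop :=
  exists f : {rmorphism A -> B},
    bijective f /\ forall c : k, f (alg_of c) = alg_of c.

Record monalg (A : pzRingType) (M : choiceType) :=
  MonAlg { mcoef : {fsfun M -> A with 0} }.

HB.instance Definition _ (A : pzRingType) (M : choiceType) :=
  [isNew for @mcoef A M].
HB.instance Definition _ (A : pzRingType) (M : choiceType) :=
  [Choice of monalg A M by <:].

Section MonAlgZmod.
Context {A : pzRingType} {M : choiceType}.
Implicit Types f g h : monalg A M.

Definition monalg0 : monalg A M := MonAlg [fsfun].
Definition monalg_opp f : monalg A M :=
  MonAlg [fsfun x in finsupp (mcoef f) => - mcoef f x].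
Definition monalg_add f g : monalg A M :=
  MonAlg [fsfun x in (finsupp (mcoef f) `|` finsupp (mcoef g))%fset =>
            mcoef f x + mcoef g x].

Definition single (c : A) (m : M) : monalg A M :=
  MonAlg [fsfun x in [fset m]%fset => c].

Lemma monalgP f g : (forall x, mcoef f x = mcoef g x) -> f = g.
Proof. by case: f g => [f] [g] h; congr MonAlg; apply/fsfunP/h. Qed.

Lemma mcoef0 x : mcoef monalg0 x = 0.
Proof. by rewrite fsfunE. Qed.

Lemma mcoefN f x : mcoef (monalg_opp f) x = - mcoef f x.
Proof. by rewrite fsfunE; case: finsuppP => //; rewrite oppr0. Qed.

Lemma mcoefD f g x : mcoef (monalg_add f g) x = mcoef f x + mcoef g x.
Proof.
rewrite fsfunE in_fsetU.
by case: (finsuppP (mcoef f)); case: (finsuppP (mcoef g)); rewrite ?addr0.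
Qed.

Lemma mcoef_single c m x : mcoef (single c m) x = if x == m then c else 0.
Proof. by rewrite fsfunE in_fset1. Qed.

Fact monalg_addA : associative monalg_add.
Proof. by move=> f g h; apply: monalgP => x; rewrite !mcoefD addrA. Qed.
Fact monalg_addC : commutative monalg_add.
Proof. by move=> f g; apply: monalgP => x; rewrite !mcoefD addrC. Qed.
Fact monalg_add0 : left_id monalg0 monalg_add.
Proof. by move=> f; apply: monalgP => x; rewrite mcoefD mcoef0 add0r. Qed.
Fact monalg_addN : left_inverse monalg0 monalg_opp monalg_add.
Proof.
by move=> f; apply: monalgP => x; rewrite mcoefD mcoefN mcoef0 addNr.
Qed.

HB.instance Definition _ := GRing.isZmodule.Build (monalg A M)
  monalg_addA monalg_addC monalg_add0 monalg_addN.

Lemma mcoef_sum (I : Type) (r : seq I) (P : pred I) (F : I -> monalg A M) x :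
  mcoef (\sum_(i <- r | P i) F i) x = \sum_(i <- r | P i) mcoef (F i) x.
Proof.
by elim/big_rec2: _ => [|i y1 y2 _ <-]; rewrite ?mcoef0 // -mcoefD.
Qed.

Lemma singleD c d m : single (c + d) m = single c m + single d m.
Proof.
apply: monalgP => x; rewrite [RHS]mcoefD !mcoef_single.
by case: eqP; rewrite ?addr0.
Qed.

Lemma single0 m : single 0 m = 0.
Proof. by apply: monalgP => x; rewrite mcoef_single mcoef0 if_same. Qed.

Lemma singleN c m : single (- c) m = - single c m.
Proof.
apply: monalgP => x; rewrite [RHS]mcoefN !mcoef_single.
by case: eqP; rewrite ?oppr0.
Qed.

Lemma monalgE f (d : {fset M}) : (finsupp (mcoef f) `<=` d)%fset ->
  f = \sum_(a <- d) single (mcoef f a) a.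
Proof.
move=> fd; apply: monalgP => x; rewrite mcoef_sum.
under eq_bigr do rewrite mcoef_single.
have [xd|xd] := boolP (x \in d).
  rewrite (big_fsetD1 x) //= eqxx big1_seq ?addr0 // => a /=.
  by rewrite in_fsetD1 eq_sym => /andP[/negPf ->].
rewrite fsfun_dflt ?big1_seq //; last exact: contra (fsubsetP fd x) xd.
by move=> a /= ad; case: eqP => // xa; rewrite xa ad in xd.
Qed.

Lemma monalg_ind (P : monalg A M -> Prop) :
    P 0 -> (forall f g, P f -> P g -> P (f + g)) -> (forall c m, P (single c m)) ->
  forall f, P f.
Proof.
by move=> P0 PD P1 f; rewrite (@monalgE f _ (fsubset_refl _)); apply: big_ind.
Qed.

End MonAlgZmod.

Section MonAlgRing.
Context {A : pzRingType} {M : monoidType}.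
Implicit Types f g h : monalg A M.

Definition monalg1 : monalg A M := single 1 1%g.
Definition monalg_mul f g : monalg A M :=
  \sum_(a <- finsupp (mcoef f)) \sum_(b <- finsupp (mcoef g))
    single (mcoef f a * mcoef g b) (a * b)%g.

Lemma monalg_mulE f g (d e : {fset M}) :
    (finsupp (mcoef f) `<=` d)%fset -> (finsupp (mcoef g) `<=` e)%fset ->
  monalg_mul f g =
    \sum_(a <- d) \sum_(b <- e) single (mcoef f a * mcoef g b) (a * b)%g.
Proof.
move=> fd ge; rewrite /monalg_mul; apply/esym.
rewrite (big_fset_incl _ fd) => [|a _ af].
  apply: eq_bigr => a _; apply/esym; apply: big_fset_incl => // b _ bg.
  by rewrite [mcoef g b]fsfun_dflt // mulr0 single0.
by rewrite big1 // => b _; rewrite fsfun_dflt // mul0r single0.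
Qed.

Lemma mul_singleE c d (a b : M) :
  monalg_mul (single c a) (single d b) = single (c * d) (a * b)%g.
Proof.
rewrite (@monalg_mulE _ _ [fset a]%fset [fset b]%fset).
- by rewrite !big_seq_fset1 !mcoef_single !eqxx.
- apply/fsubsetP => x; rewrite mem_finsupp mcoef_single in_fset1.
  by case: (x == a); rewrite ?eqxx.
- apply/fsubsetP => x; rewrite mem_finsupp mcoef_single in_fset1.
  by case: (x == b); rewrite ?eqxx.
Qed.

Fact monalg_mulDl : left_distributive monalg_mul +%R.
Proof.
move=> f g h; pose d := (finsupp (mcoef f) `|` finsupp (mcoef g) `|`
  finsupp (mcoef (f + g)%R))%fset.
rewrite !(@monalg_mulE _ h d (finsupp (mcoef h))) //; first last.
- by apply/fsubsetP => x xf; rewrite !in_fsetU xf ?orbT.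
- by apply/fsubsetP => x xf; rewrite !in_fsetU xf ?orbT.
- by apply/fsubsetP => x xf; rewrite !in_fsetU xf ?orbT.
rewrite -big_split; apply: eq_bigr => a _ /=.
rewrite -big_split; apply: eq_bigr => b _ /=.
by rewrite -singleD [mcoef (_ + _) _]mcoefD mulrDl.
Qed.

Fact monalg_mulDr : right_distributive monalg_mul +%R.
Proof.
move=> h f g; pose d := (finsupp (mcoef f) `|` finsupp (mcoef g) `|`
  finsupp (mcoef (f + g)%R))%fset.
rewrite !(@monalg_mulE h _ (finsupp (mcoef h)) d) //; first last.
- by apply/fsubsetP => x xf; rewrite !in_fsetU xf ?orbT.
- by apply/fsubsetP => x xf; rewrite !in_fsetU xf ?orbT.
- by apply/fsubsetP => x xf; rewrite !in_fsetU xf ?orbT.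
rewrite -big_split; apply: eq_bigr => a _ /=.
rewrite -big_split; apply: eq_bigr => b _ /=.
by rewrite -singleD [mcoef (_ + _) _]mcoefD mulrDr.
Qed.

Lemma monalg_mul0l f : monalg_mul 0 f = 0.
Proof. by apply: (addIr (monalg_mul 0 f)); rewrite -monalg_mulDl !add0r. Qed.
Lemma monalg_mul0r f : monalg_mul f 0 = 0.
Proof. by apply: (addIr (monalg_mul f 0)); rewrite -monalg_mulDr !add0r. Qed.

Fact monalg_mulA : associative monalg_mul.
Proof.
move=> f g h; elim/(@monalg_ind A M): f => [|f f' IH IH'|c a].
- by rewrite !monalg_mul0l.
- by rewrite !monalg_mulDl IH IH'.
elim/(@monalg_ind A M): g => [|g g' IH IH'|d b].
- by rewrite !(monalg_mul0l, monalg_mul0r).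
- by rewrite !(monalg_mulDl, monalg_mulDr) IH IH'.
elim/(@monalg_ind A M): h => [|h h' IH IH'|e m].
- by rewrite !monalg_mul0r.
- by rewrite !monalg_mulDr IH IH'.
by rewrite !mul_singleE mulrA mulgA.
Qed.

Fact monalg_mul1l : left_id monalg1 monalg_mul.
Proof.
elim/(@monalg_ind A M) => [|f g IH IH'|c a]; rewrite ?monalg_mul0r //.
  by rewrite monalg_mulDr IH IH'.
by rewrite mul_singleE mul1r mul1g.
Qed.

Fact monalg_mul1r : right_id monalg1 monalg_mul.
Proof.
elim/(@monalg_ind A M) => [|f g IH IH'|c a]; rewrite ?monalg_mul0l //.
  by rewrite monalg_mulDl IH IH'.
by rewrite mul_singleE mulr1 mulg1.
Qed.

HB.instance Definition _ := GRing.Zmodule_isPzRing.Build (monalg A M)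
  monalg_mulA monalg_mul1l monalg_mul1r monalg_mulDl monalg_mulDr.

Lemma singleM c d (a b : M) :
  single c a * single d b = single (c * d) (a * b)%g.
Proof. exact: mul_singleE. Qed.

End MonAlgRing.

Section MonAlgAlg.
Context {k : comPzRingType} {M : monoidType}.

Definition monalg_const (c : k) : monalg k M := single c 1%g.

Fact monalg_constD : {morph monalg_const : c d / c + d}.
Proof. by move=> c d; apply: singleD. Qed.
Fact monalg_constM : {morph monalg_const : c d / c * d}.
Proof. by move=> c d; rewrite [RHS]singleM mulg1. Qed.
Fact monalg_const1 : monalg_const 1 = 1. Proof. by []. Qed.
Fact monalg_constC c f : monalg_const c * f = f * monalg_const c.
Proof.
elim/(@monalg_ind k M): f => [|f g IH IH'|d a]; first by rewrite mulr0 mul0r.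
  by rewrite mulrDl mulrDr IH IH'.
by rewrite !singleM mulrC mul1g mulg1.
Qed.

HB.instance Definition _ := isAlgOver.Build k (monalg k M)
  monalg_constD monalg_constM monalg_const1 monalg_constC.

End MonAlgAlg.

Definition mono {A : pzRingType} {M : monoidType} (m : M) : monalg A M :=
  single 1 m.

Section QuotientRing.
Context {A : pzRingType}.

Definition two_sided_ideal (J : set A) : Prop :=
  [/\ J 0, forall a b, J a -> J b -> J (a - b)
    & forall a b c, J b -> J (a * b * c)].

Definition ideal_gen (S : set A) : set A :=
  [set a | forall J, two_sided_ideal J -> S `<=` J -> J a].

Variable S : set A.

Lemma ideal_genP : two_sided_ideal (ideal_gen S).
Proof.
split=> [J [] // | a b Ja Jb J JI SJ | a b c Jb J JI SJ].
- by have [_ + _] := JI; apply; [apply: Ja | apply: Jb].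
- by have [_ _] := JI; apply; apply: Jb.
Qed.

Lemma ideal_gen_sub : S `<=` ideal_gen S.
Proof. by move=> a Sa J _; apply. Qed.

Lemma ideal_gen0 : ideal_gen S 0. Proof. by case: ideal_genP. Qed.
Lemma ideal_genB a b :
  ideal_gen S a -> ideal_gen S b -> ideal_gen S (a - b).
Proof. by case: ideal_genP => _ + _; apply. Qed.
Lemma ideal_genM a b c : ideal_gen S b -> ideal_gen S (a * b * c).
Proof. by case: ideal_genP => _ _; apply. Qed.
Lemma ideal_genN a : ideal_gen S a -> ideal_gen S (- a).
Proof. by move=> Ja; rewrite -sub0r; apply: ideal_genB => //; apply: ideal_gen0. Qed.
Lemma ideal_genD a b :
  ideal_gen S a -> ideal_gen S b -> ideal_gen S (a + b).
Proof. by move=> Ja Jb; rewrite -[b]opprK; apply: ideal_genB => //; apply: ideal_genN. Qed.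

Definition quot_rel (a b : A) : bool := `[< ideal_gen S (a - b) >].

Fact quot_rel_refl : reflexive quot_rel.
Proof. by move=> a; apply/asboolP; rewrite subrr; apply: ideal_gen0. Qed.
Fact quot_rel_sym : symmetric quot_rel.
Proof.
move=> a b; apply: asbool_equiv_eq.
by split=> /ideal_genN; rewrite opprB.
Qed.
Fact quot_rel_trans : transitive quot_rel.
Proof.
move=> b a c /asboolP ab /asboolP bc; apply/asboolP.
by rewrite -(subrK b a) -addrA; apply: ideal_genD.
Qed.

Canonical quot_equiv := EquivRel quot_rel quot_rel_refl quot_rel_sym quot_rel_trans.

Definition quot : Type := {eq_quot quot_equiv}.
HB.instance Definition _ := Choice.on quot.
HB.instance Definition _ := EqQuotient.on quot.

Definition cls (a : A) : quot := \pi_quot a.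

Lemma clsP a b : reflect (ideal_gen S (a - b)) (cls a == cls b).
Proof. by rewrite eqmodE; apply: asboolP. Qed.

Lemma cls_eq a b : ideal_gen S (a - b) -> cls a = cls b.
Proof. by move=> /clsP /eqP. Qed.

Lemma reprB a : ideal_gen S (generic_quotient.repr (cls a) - a).
Proof. by apply/clsP; rewrite /cls reprK. Qed.

Definition quot_opp (x : quot) : quot := cls (- generic_quotient.repr x).
Definition quot_add (x y : quot) : quot := cls (generic_quotient.repr x + generic_quotient.repr y).
Definition quot_mul (x y : quot) : quot := cls (generic_quotient.repr x * generic_quotient.repr y).

Lemma cls_opp a : quot_opp (cls a) = cls (- a).
Proof. by apply: cls_eq; rewrite -opprD; apply: ideal_genN; apply: reprB. Qed.

Lemma cls_add a b : quot_add (cls a) (cls b) = cls (a + b).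
Proof.
by apply: cls_eq; rewrite opprD addrACA; apply: ideal_genD; apply: reprB.
Qed.

Lemma cls_mul a b : quot_mul (cls a) (cls b) = cls (a * b).
Proof.
apply: cls_eq; set a' := generic_quotient.repr _; set b' := generic_quotient.repr _.
have -> : a' * b' - a * b = 1 * (a' - a) * b' + a * (b' - b) * 1.
  by rewrite mul1r mulr1 mulrBl mulrBr addrA subrK.
by apply: ideal_genD; apply: ideal_genM; apply: reprB.
Qed.

Lemma quotW (P : quot -> Prop) : (forall a, P (cls a)) -> forall x, P x.
Proof. by move=> PA x; rewrite -[x]reprK; apply: PA. Qed.

Fact quot_addA : associative quot_add.
Proof.
elim/quotW => a; elim/quotW => b; elim/quotW => c.
by rewrite !cls_add addrA.
Qed.
Fact quot_addC : commutative quot_add.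
Proof. by elim/quotW => a; elim/quotW => b; rewrite !cls_add addrC. Qed.
Fact quot_add0 : left_id (cls 0) quot_add.
Proof. by elim/quotW => a; rewrite cls_add add0r. Qed.
Fact quot_addN : left_inverse (cls 0) quot_opp quot_add.
Proof. by elim/quotW => a; rewrite cls_opp cls_add addNr. Qed.

HB.instance Definition _ := GRing.isZmodule.Build quot
  quot_addA quot_addC quot_add0 quot_addN.

Fact quot_mulA : associative quot_mul.
Proof.
elim/quotW => a; elim/quotW => b; elim/quotW => c.
by rewrite !cls_mul mulrA.
Qed.
Fact quot_mul1l : left_id (cls 1) quot_mul.
Proof. by elim/quotW => a; rewrite cls_mul mul1r. Qed.
Fact quot_mul1r : right_id (cls 1) quot_mul.
Proof. by elim/quotW => a; rewrite cls_mul mulr1. Qed.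
Fact quot_mulDl : left_distributive quot_mul +%R.
Proof.
elim/quotW => a; elim/quotW => b; elim/quotW => c.
by rewrite [_ + _]cls_add !cls_mul mulrDl [RHS]cls_add.
Qed.
Fact quot_mulDr : right_distributive quot_mul +%R.
Proof.
elim/quotW => a; elim/quotW => b; elim/quotW => c.
by rewrite [_ + _]cls_add !cls_mul mulrDr [RHS]cls_add.
Qed.

HB.instance Definition _ := GRing.Zmodule_isPzRing.Build quot
  quot_mulA quot_mul1l quot_mul1r quot_mulDl quot_mulDr.

Fact cls_is_zmod_morphism : zmod_morphism cls.
Proof. by move=> a b; rewrite -[RHS]/(quot_add _ (quot_opp _)) cls_opp cls_add. Qed.
Fact cls_is_monoid_morphism : GRing.monoid_morphism cls.
Proof. by split=> // a b; rewrite -[RHS]/(quot_mul _ _) cls_mul. Qed.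
HB.instance Definition _ := GRing.isZmodMorphism.Build A quot cls cls_is_zmod_morphism.
HB.instance Definition _ := GRing.isMonoidMorphism.Build A quot cls cls_is_monoid_morphism.

End QuotientRing.

Section QuotientAlg.
Context {k : comPzRingType} {A : algOver k} (S : set A).

Definition quot_const (c : k) : quot S := cls S (alg_of c).
Fact quot_constD : {morph quot_const : c d / c + d}.
Proof. by move=> c d; rewrite /quot_const alg_ofD rmorphD. Qed.
Fact quot_constM : {morph quot_const : c d / c * d}.
Proof. by move=> c d; rewrite /quot_const alg_ofM rmorphM. Qed.
Fact quot_const1 : quot_const 1 = 1.
Proof. by rewrite /quot_const alg_of1. Qed.
Fact quot_constC c a : quot_const c * a = a * quot_const c.
Proof. by elim/(@quotW A S): a => a; rewrite /quot_const -!rmorphM alg_ofC. Qed.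

HB.instance Definition _ := isAlgOver.Build k (quot S)
  quot_constD quot_constM quot_const1 quot_constC.
End QuotientAlg.

Section MatrixAlg.
Context {k : comPzRingType} (A : algOver k) (n : nat).

Definition mx_const (c : k) : 'M[A]_n := (alg_of c)%:M.
Fact mx_constD : {morph mx_const : c d / c + d}.
Proof. by move=> c d; rewrite /mx_const alg_ofD raddfD. Qed.
Fact mx_constM : {morph mx_const : c d / c * d}.
Proof. by move=> c d; rewrite /mx_const alg_ofM scalar_mxM. Qed.
Fact mx_const1 : mx_const 1 = 1.
Proof. by rewrite /mx_const alg_of1. Qed.
Fact mx_constC c (a : 'M[A]_n) : mx_const c * a = a * mx_const c.
Proof.
apply/matrixP => i j; rewrite [LHS]mxE [RHS]mxE.
rewrite (bigD1 i) //= big1 ?addr0 => [|l /negPf li]; last first.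
  by rewrite mxE eq_sym li mul0r.
rewrite (bigD1 j) //= big1 ?addr0 => [|l /negPf lj]; last first.
  by rewrite mxE lj mulr0.
by rewrite !mxE !eqxx alg_ofC.
Qed.

HB.instance Definition _ := isAlgOver.Build k 'M[A]_n
  mx_constD mx_constM mx_const1 mx_constC.
End MatrixAlg.

Definition dsum (k : comPzRingType) (I : finType) (A : I -> algOver k) : Type :=
  forall i, A i.

Section DirectSum.
Context {k : comPzRingType} {I : finType} (A : I -> algOver k).
Local Notation D := (dsum A).

HB.instance Definition _ := gen_eqMixin D.
HB.instance Definition _ := gen_choiceMixin D.

Definition dsum0 : D := fun=> 0.
Definition dsum1 : D := fun=> 1.
Definition dsum_opp (f : D) : D := fun i => - f i.
Definition dsum_add (f g : D) : D := fun i => f i + g i.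
Definition dsum_mul (f g : D) : D := fun i => f i * g i.
Definition dsum_const (c : k) : D := fun=> alg_of c.

Lemma dsumP (f g : D) : (forall i, f i = g i) -> f = g.
Proof. exact: functional_extensionality_dep. Qed.

Fact dsum_addA : associative dsum_add.
Proof. by move=> f g h; apply: dsumP => i; apply: addrA. Qed.
Fact dsum_addC : commutative dsum_add.
Proof. by move=> f g; apply: dsumP => i; apply: addrC. Qed.
Fact dsum_add0 : left_id dsum0 dsum_add.
Proof. by move=> f; apply: dsumP => i; apply: add0r. Qed.
Fact dsum_addN : left_inverse dsum0 dsum_opp dsum_add.
Proof. by move=> f; apply: dsumP => i; apply: addNr. Qed.

HB.instance Definition _ := GRing.isZmodule.Build D
  dsum_addA dsum_addC dsum_add0 dsum_addN.

Fact dsum_mulA : associative dsum_mul.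
Proof. by move=> f g h; apply: dsumP => i; apply: mulrA. Qed.
Fact dsum_mul1l : left_id dsum1 dsum_mul.
Proof. by move=> f; apply: dsumP => i; apply: mul1r. Qed.
Fact dsum_mul1r : right_id dsum1 dsum_mul.
Proof. by move=> f; apply: dsumP => i; apply: mulr1. Qed.
Fact dsum_mulDl : left_distributive dsum_mul +%R.
Proof. by move=> f g h; apply: dsumP => i; apply: mulrDl. Qed.
Fact dsum_mulDr : right_distributive dsum_mul +%R.
Proof. by move=> f g h; apply: dsumP => i; apply: mulrDr. Qed.

HB.instance Definition _ := GRing.Zmodule_isPzRing.Build D
  dsum_mulA dsum_mul1l dsum_mul1r dsum_mulDl dsum_mulDr.

Fact dsum_constD : {morph dsum_const : c d / c + d}.
Proof. by move=> c d; apply: dsumP => i; apply: alg_ofD. Qed.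
Fact dsum_constM : {morph dsum_const : c d / c * d}.
Proof. by move=> c d; apply: dsumP => i; apply: alg_ofM. Qed.
Fact dsum_const1 : dsum_const 1 = 1.
Proof. by apply: dsumP => i; apply: alg_of1. Qed.
Fact dsum_constC c f : dsum_const c * f = f * dsum_const c.
Proof. by apply: dsumP => i; apply: alg_ofC. Qed.

HB.instance Definition _ := isAlgOver.Build k D
  dsum_constD dsum_constM dsum_const1 dsum_constC.
End DirectSum.

(* A \otimes_S k for an S-algebra A and a morphism phi : S -> k. The multiplicative
   monoid A x k has the additive group Z[A x k] as its monoid ring, and the
   bilinearity relations are stable under multiplication by pairs, so that the
   ideal they generate is the subgroup they generate. *)
Definition tensor_pair (A k : Type) : Type := (A * k)%type.

Section TensorPair.
Context {A : pzRingType} {k : comPzRingType}.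
Local Notation P := (tensor_pair A k).
HB.instance Definition _ := Choice.copy P (A * k)%type.
Definition tpair_one : P := (1, 1).
Definition tpair_mul (p q : P) : P := (p.1 * q.1, p.2 * q.2).
Fact tpair_mulA : associative tpair_mul.
Proof. by move=> p q r; rewrite /tpair_mul !mulrA. Qed.
Fact tpair_mul1l : left_id tpair_one tpair_mul.
Proof. by case=> a c; rewrite /tpair_mul !mul1r. Qed.
Fact tpair_mul1r : right_id tpair_one tpair_mul.
Proof. by case=> a c; rewrite /tpair_mul !mulr1. Qed.
HB.instance Definition _ := isMonoid.Build P tpair_mulA tpair_mul1l tpair_mul1r.
End TensorPair.

Section BaseChange.
Context {S k : comPzRingType} (phi : {rmorphism S -> k}) (A : algOver S).

Let T (a : A) (c : k) : monalg int (tensor_pair A k) :=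
  mono ((a, c) : tensor_pair A k).

Definition tensor_rel : set (monalg int (tensor_pair A k)) :=
  [set z | exists a b c, z = T (a + b) c - T a c - T b c]
  `|` [set z | exists a c d, z = T a (c + d) - T a c - T a d]
  `|` [set z | exists (s : S) a c, z = T (alg_of s * a) c - T a (phi s * c)].

Definition base_change : Type := quot tensor_rel.
HB.instance Definition _ := GRing.PzRing.on base_change.

Definition tensor (a : A) (c : k) : base_change := cls tensor_rel (T a c).

Lemma tensorDl a b c : tensor (a + b) c = tensor a c + tensor b c.
Proof.
rewrite /tensor -rmorphD; apply: cls_eq; apply: ideal_gen_sub.
by left; left; exists a, b, c; rewrite opprD addrA.
Qed.
Lemma tensorDr a c d : tensor a (c + d) = tensor a c + tensor a d.
Proof.
rewrite /tensor -rmorphD; apply: cls_eq; apply: ideal_gen_sub.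
by left; right; exists a, c, d; rewrite opprD addrA.
Qed.
Lemma tensorZ s a c : tensor (alg_of s * a) c = tensor a (phi s * c).
Proof. by apply: cls_eq; apply: ideal_gen_sub; right; exists s, a, c. Qed.
Lemma tensorM a b c d : tensor a c * tensor b d = tensor (a * b) (c * d).
Proof. by rewrite /tensor -rmorphM /T /mono singleM mulr1. Qed.

Lemma base_change_ind (P : base_change -> Prop) :
    P 0 -> (forall x y, P x -> P y -> P (x + y)) ->
    (forall x, P x -> P (- x)) -> (forall a c, P (tensor a c)) ->
  forall x, P x.
Proof.
move=> P0 PD PN PT; elim/(@quotW _ tensor_rel); elim/(@monalg_ind int (tensor_pair A k)) => [|f g Pf Pg|z [a c]].
- by rewrite rmorph0.
- by rewrite rmorphD; apply: PD.
have PTn (i : nat) : P (cls tensor_rel (single i%:Z ((a, c) : tensor_pair A k))).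
  elim: i => [|i IH]; first by rewrite single0 rmorph0.
  by rewrite -addn1 PoszD singleD rmorphD; apply: PD => //; apply: PT.
case: z => i //; rewrite NegzE.
by rewrite singleN rmorphN; apply: PN; apply: PTn.
Qed.

Definition base_change_const (c : k) : base_change := tensor 1 c.
Fact base_change_constD : {morph base_change_const : c d / c + d}.
Proof. by move=> c d; apply: tensorDr. Qed.
Fact base_change_constM : {morph base_change_const : c d / c * d}.
Proof. by move=> c d; rewrite [RHS]tensorM mulr1. Qed.
Fact base_change_const1 : base_change_const 1 = 1.
Proof. by rewrite -[RHS](rmorph1 (cls tensor_rel)). Qed.
Fact base_change_constC c x : base_change_const c * x = x * base_change_const c.
Proof.
elim/base_change_ind: x => [|x y IH IH'|x IH|a d].
- by rewrite mulr0 mul0r.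
- by rewrite mulrDl mulrDr IH IH'.
- by rewrite mulrN mulNr IH.
by rewrite !tensorM mul1r mulr1 mulrC.
Qed.

HB.instance Definition _ := isAlgOver.Build k base_change
  base_change_constD base_change_constM base_change_const1 base_change_constC.
End BaseChange.

Section GeneratedSubring.
Context {A : comPzRingType} (S : set A).

Definition gen_subring : pred A :=
  fun a => `[< forall P : {pred A}, GRing.subring_closed P ->
                 (forall b, S b -> b \in P) -> a \in P >].

Fact gen_subring_closed : GRing.subring_closed gen_subring.
Proof.
split=> [|a b /asboolP Ha /asboolP Hb|a b /asboolP Ha /asboolP Hb].
- by apply/asboolP => P [].
- by apply/asboolP => P cP SP; case: (cP) => _ + _; apply; [apply: Ha|apply: Hb].
- by apply/asboolP => P cP SP; case: (cP) => _ _; apply; [apply: Ha|apply: Hb].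
Qed.

Lemma gen_subring_mem a : S a -> a \in gen_subring.
Proof. by move=> Sa; apply/asboolP => P _; apply. Qed.

Record subring_of := SubringOf { subring_val : A; _ : subring_val \in gen_subring }.
HB.instance Definition _ := [isSub for subring_val].
HB.instance Definition _ := [Choice of subring_of by <:].
HB.instance Definition _ :=
  GRing.SubChoice_isSubComPzRing.Build A gen_subring subring_of gen_subring_closed.
End GeneratedSubring.
(* The complex numbers R[i], seen as a numClosedFieldType in order to inherit the
   topology that the library puts on every numFieldType. *)
Definition Cx (R : realType) : numClosedFieldType := R[i].

Definition expi (R : realType) (x : R) : Cx R := (cos x +i* sin x)%C.

Definition unitI (R : realType) : Type := {t : R | 0 <= t <= 1}.

Section UnitInterval.
Context {R : realType}.
Local Notation I := (unitI R).

HB.instance Definition _ := Choice.copy I {t : R | 0 <= t <= 1}.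
HB.instance Definition _ := Topological.copy I
  (initial_topology (val : {t : R | 0 <= t <= 1} -> R)).

Definition ival (t : I) : R := val (t : {t : R | 0 <= t <= 1}).

Lemma ivalP (t : I) : 0 <= ival t <= 1.
Proof. exact: (valP (t : {t : R | 0 <= t <= 1})). Qed.

Lemma ival_inj : injective ival. Proof. exact: val_inj. Qed.

Lemma ival_continuous : continuous ival.
Proof. exact: initial_continuous. Qed.

Fact clamp_subproof (r : R) : 0 <= Num.max 0 (Num.min r 1) <= 1.
Proof. by rewrite le_max lexx /= ge_max ler01 ge_min lexx orbT. Qed.
Definition clamp (r : R) : I := exist _ (Num.max 0 (Num.min r 1)) (clamp_subproof r).

Lemma clampE r : 0 <= r <= 1 -> ival (clamp r) = r.
Proof. by case/andP=> r0 r1; rewrite /ival /= (min_idPl r1) (max_idPr r0). Qed.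
Lemma clampK t : clamp (ival t) = t.
Proof. by apply: ival_inj; rewrite clampE // ivalP. Qed.
Lemma clamp_le0 r : r <= 0 -> ival (clamp r) = 0.
Proof. by move=> r0; rewrite /ival /= (max_idPl _) // ge_min r0. Qed.
Lemma clamp_ge1 r : 1 <= r -> ival (clamp r) = 1.
Proof. by move=> r1; rewrite /ival /= (min_idPr r1) (max_idPr ler01). Qed.

Lemma clamp_continuous : continuous clamp.
Proof.
apply: continuous_comp_initial => r; rewrite /comp /=.
apply: (@continuous_max R R (cst 0) (fun r => Num.min r 1)); first exact: cvg_cst.
by apply: continuous_min; [exact: cvg_id | exact: cvg_cst].
Qed.

Definition i0 : I := clamp 0.
Definition i1 : I := clamp 1.
Lemma ival0 : ival i0 = 0. Proof. by rewrite clampE // lexx ler01. Qed.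
Lemma ival1 : ival i1 = 1. Proof. by rewrite clampE // lexx ler01. Qed.
Fact i0_neq_i1 : i0 != i1.
Proof. by apply/eqP => /(congr1 ival)/eqP; rewrite ival0 ival1 eq_sym oner_eq0. Qed.
HB.instance Definition _ := isBiPointed.Build I i0_neq_i1.

End UnitInterval.
Lemma pair_continuous (Z X Y : topologicalType) (f : Z -> X) (g : Z -> Y) :
  continuous f -> continuous g -> continuous (fun z => (f z, g z)).
Proof. by move=> cf cg z; apply: cvg_pair; [apply: cf | apply: cg]. Qed.

Lemma glue_continuous (R : realType) (Z T : topologicalType) (c : Z -> R) (a : R)
    (F G : Z -> T) :
    continuous c -> continuous F -> continuous G ->
    (forall z, c z = a -> F z = G z) ->
  continuous (fun z => if c z <= a then F z else G z).
Proof.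
move=> cc cF cG FG z U UFz.
have zT : Filter (nbhs z) by apply: nbhs_filter.
suff : nbhs z ((fun z => if c z <= a then F z else G z) @^-1` U) by [].
move: UFz; have [cza|acz|cza] := ltgtP (c z) a => /= UFz.
- have near_z : \forall x \near z, c x < a by exact: (cc z _ (lt_nbhsl cza)).
  by apply: (filterS2 zT _ (cF z U UFz) near_z) => x UFx /ltW cxa; rewrite /= cxa.
- have near_z : \forall x \near z, a < c x by exact: (cc z _ (lt_nbhsr acz)).
  apply: (filterS2 zT _ (cG z U UFz) near_z) => x UGx acx.
  by rewrite /= leNgt acx.
- have UGz : nbhs (G z) U by rewrite -FG.
  apply: (filterS2 zT _ (cF z U UFz) (cG z U UGz)) => x UFx UGx /=.
  by case: ifP.
Qed.

Section Homotopy.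
Context {R : realType} {T : topologicalType}.
Local Notation I := (unitI R).
Implicit Types f g h : I -> T.

Definition path_homotopic f g : Prop :=
  exists h : I * I -> T, continuous h /\
    [/\ forall t, h (zero, t) = f t, forall t, h (one, t) = g t,
        forall s, h (s, zero) = f zero & forall s, h (s, one) = f one].

Lemma path_homotopic_ends f g : path_homotopic f g ->
  f zero = g zero /\ f one = g one.
Proof. by case=> h [_ [h0 h1 hz ho]]; rewrite -!h1 hz ho. Qed.

Lemma cont_clamp (Z : topologicalType) (c : Z -> R) :
  continuous c -> continuous (clamp \o c).
Proof. by move=> cc z; apply: continuous_comp; [apply: cc|apply: clamp_continuous]. Qed.

Lemma cont_comp (X Y Z : topologicalType) (u : Y -> Z) (v : X -> Y) :
  continuous u -> continuous v -> continuous (u \o v).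
Proof. by move=> cu cv z; apply: continuous_comp; [apply: cv|apply: cu]. Qed.

Lemma cont_ival (Z : topologicalType) (c : Z -> I) :
  continuous c -> continuous (ival \o c).
Proof. exact: (cont_comp ival_continuous). Qed.

Lemma cont_fst (X Y : topologicalType) : continuous (@fst X Y).
Proof. by move=> z; apply: cvg_fst. Qed.
Lemma cont_snd (X Y : topologicalType) : continuous (@snd X Y).
Proof. by move=> z; apply: cvg_snd. Qed.

Lemma cont_add (Z : topologicalType) (c d : Z -> R) :
  continuous c -> continuous d -> continuous (fun z => c z + d z).
Proof. by move=> cc cd z; apply: cvgD; [apply: cc|apply: cd]. Qed.
Lemma cont_sub (Z : topologicalType) (c d : Z -> R) :
  continuous c -> continuous d -> continuous (fun z => c z - d z).
Proof. by move=> cc cd z; apply: cvgB; [apply: cc|apply: cd]. Qed.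
Lemma cont_mul (Z : topologicalType) (c d : Z -> R) :
  continuous c -> continuous d -> continuous (fun z => c z * d z).
Proof. by move=> cc cd z; apply: cvgM; [apply: cc|apply: cd]. Qed.
Lemma cont_cst (Z T' : topologicalType) (x : T') : continuous (fun _ : Z => x).
Proof. by move=> z; apply: cvg_cst. Qed.
Lemma cont_id (Z : topologicalType) : continuous (fun z : Z => z).
Proof. by move=> z; apply: cvg_id. Qed.
Lemma cont_min (Z : topologicalType) (c d : Z -> R) :
  continuous c -> continuous d -> continuous (fun z => Num.min (c z) (d z)).
Proof. by move=> cc cd z; apply: continuous_min; [apply: cc|apply: cd]. Qed.
Lemma cont_max (Z : topologicalType) (c d : Z -> R) :
  continuous c -> continuous d -> continuous (fun z => Num.max (c z) (d z)).
Proof. by move=> cc cd z; apply: continuous_max; [apply: cc|apply: cd]. Qed.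

Lemma path_homotopic_refl f : continuous f -> path_homotopic f f.
Proof.
move=> cf; exists (f \o snd); split; first by apply: cont_comp => //; apply: cont_snd.
by split.
Qed.

Definition irev (t : I) : I := clamp (1 - ival t).
Lemma irev_continuous : continuous irev.
Proof. by apply: cont_clamp; apply: cont_sub; [apply: cont_cst | apply: ival_continuous]. Qed.
Lemma ival_rev t : ival (irev t) = 1 - ival t.
Proof. by rewrite clampE //; have /andP[] := ivalP t; lra. Qed.
Lemma irev0 : irev zero = one.
Proof. by apply: ival_inj; rewrite ival_rev ival0 ival1 subr0. Qed.
Lemma irev1 : irev one = zero.
Proof. by apply: ival_inj; rewrite ival_rev ival0 ival1 subrr. Qed.

Lemma path_homotopic_sym f g : path_homotopic f g -> path_homotopic g f.
Proof.
move=> fg; have [fg0 fg1] := path_homotopic_ends fg.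
case: fg => h [ch [h0 h1 hz ho]].
exists (fun st => h (irev st.1, st.2)); split.
  apply: (cont_comp ch); apply: pair_continuous; last exact: cont_snd.
  by apply: (cont_comp irev_continuous); apply: cont_fst.
split=> [t|t|s|s] /=; first by rewrite irev0 h1.
- by rewrite irev1 h0.
- by rewrite hz.
- by rewrite ho.
Qed.

Definition fst_half (t : I) : I := clamp (2 * ival t).
Definition snd_half (t : I) : I := clamp (2 * ival t - 1).
Lemma fst_half_continuous : continuous fst_half.
Proof. by apply: cont_clamp; apply: cont_mul; [apply: cont_cst | apply: ival_continuous]. Qed.
Lemma snd_half_continuous : continuous snd_half.
Proof.
apply: cont_clamp; apply: cont_sub; last exact: cont_cst.
by apply: cont_mul; [apply: cont_cst | apply: ival_continuous].
Qed.

Lemma half_fst t : ival t = 2^-1 -> fst_half t = one.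
Proof. by move=> t2; apply: ival_inj; rewrite ival1 clamp_ge1 // t2; lra. Qed.
Lemma half_snd t : ival t = 2^-1 -> snd_half t = zero.
Proof. by move=> t2; apply: ival_inj; rewrite ival0 clamp_le0 // t2; lra. Qed.

Lemma path_homotopic_trans g f h :
  path_homotopic f g -> path_homotopic g h -> path_homotopic f h.
Proof.
move=> fg; have [fg0 fg1] := path_homotopic_ends fg.
case: fg => u [cu [u0 u1 uz uo]] [v [cv [v0 v1 vz vo]]].
exists (fun st => if ival st.1 <= 2^-1 then u (fst_half st.1, st.2)
                  else v (snd_half st.1, st.2)); split.
  apply: glue_continuous => [|||st st2].
  - by apply: (cont_comp ival_continuous); apply: cont_fst.
  - apply: (cont_comp cu); apply: pair_continuous; last exact: cont_snd.
    by apply: (cont_comp fst_half_continuous); apply: cont_fst.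
  - apply: (cont_comp cv); apply: pair_continuous; last exact: cont_snd.
    by apply: (cont_comp snd_half_continuous); apply: cont_fst.
  - by rewrite half_fst // half_snd // u1 v0.
split=> [t|t|s|s] /=.
- rewrite ival0 invr_ge0 ler0n -u0; congr (u (_, _)).
  by apply: ival_inj; rewrite clamp_le0 ?ival0 // mulr0.
- rewrite ival1 ifF; last by apply/negP; lra.
  rewrite -v1; congr (v (_, _)).
  by apply: ival_inj; rewrite clamp_ge1 ?ival1 //; lra.
- by rewrite uz vz fg0 if_same.
- by rewrite uo vo fg1 if_same.
Qed.

Lemma path_homotopic_reparam f (p q : I -> I) :
    continuous f -> continuous p -> continuous q ->
    p zero = q zero -> p one = q one ->
  path_homotopic (f \o p) (f \o q).
Proof.
move=> cf cp cq pq0 pq1.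
pose c (st : I * I) := (1 - ival st.1) * ival (p st.2) + ival st.1 * ival (q st.2).
exists (fun st => f (clamp (c st))); split.
  apply: (cont_comp cf); apply: cont_clamp; apply: cont_add; apply: cont_mul.
  - apply: cont_sub; first exact: cont_cst.
    by apply: cont_ival; apply: cont_fst.
  - by apply: cont_ival; apply: (cont_comp cp); apply: cont_snd.
  - by apply: cont_ival; apply: cont_fst.
  - by apply: cont_ival; apply: (cont_comp cq); apply: cont_snd.
by split=> [t|t|s|s] /=; congr f; rewrite /c /= -[RHS]clampK;
  congr clamp; rewrite -?pq0 -?pq1 ?ival0 ?ival1; lra.
Qed.

Definition cat_fun f g : I -> T :=
  fun t => if ival t <= 2^-1 then f (fst_half t) else g (snd_half t).

Lemma cat_continuous f g : continuous f -> continuous g -> f one = g zero ->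
  continuous (cat_fun f g).
Proof.
move=> cf cg fg; apply: glue_continuous => [|||t t2].
- exact: ival_continuous.
- by apply: (cont_comp cf); apply: fst_half_continuous.
- by apply: (cont_comp cg); apply: snd_half_continuous.
- by rewrite half_fst // half_snd.
Qed.

Lemma cat0 f g : cat_fun f g zero = f zero.
Proof.
rewrite /cat_fun ival0 invr_ge0 ler0n; congr f.
by apply: ival_inj; rewrite clamp_le0 ?ival0 // mulr0.
Qed.
Lemma cat1 f g : cat_fun f g one = g one.
Proof.
rewrite /cat_fun ival1 ifF; last by apply/negP; lra.
by congr g; apply: ival_inj; rewrite clamp_ge1 ?ival1 //; lra.
Qed.

Lemma path_homotopic_cat f g f' g' : f one = g zero ->
    path_homotopic f f' -> path_homotopic g g' ->
  path_homotopic (cat_fun f g) (cat_fun f' g').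
Proof.
move=> fg [u [cu [u0 u1 uz uo]]] [v [cv [v0 v1 vz vo]]].
exists (fun st => if ival st.2 <= 2^-1 then u (st.1, fst_half st.2)
                  else v (st.1, snd_half st.2)); split.
  apply: glue_continuous => [|||st st2].
  - by apply: (cont_comp ival_continuous); apply: cont_snd.
  - apply: (cont_comp cu); apply: pair_continuous; first exact: cont_fst.
    by apply: (cont_comp fst_half_continuous); apply: cont_snd.
  - apply: (cont_comp cv); apply: pair_continuous; first exact: cont_fst.
    by apply: (cont_comp snd_half_continuous); apply: cont_snd.
  - by rewrite half_fst // half_snd // uo vz.
split=> [t|t|s|s] /=.
- by rewrite u0 v0.
- by rewrite u1 v1.
- rewrite cat0 ival0 invr_ge0 ler0n -(uz s); congr (u (_, _)).
  by apply: ival_inj; rewrite clamp_le0 ?ival0 // mulr0.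
- rewrite cat1 ival1 ifF; last by apply/negP; lra.
  rewrite -(vo s); congr (v (_, _)).
  by apply: ival_inj; rewrite clamp_ge1 ?ival1 //; lra.
Qed.

Lemma cat_cstr f x : continuous f -> f one = x ->
  path_homotopic (cat_fun f (fun=> x)) f.
Proof.
move=> cf fx; have -> : cat_fun f (fun=> x) = f \o fst_half.
  apply/funext => t; rewrite /cat_fun; case: ifPn => //; rewrite -ltNge => t2.
  rewrite -fx; congr f; apply: ival_inj; rewrite ival1 [RHS]clamp_ge1 //; lra.
have -> : path_homotopic (f \o fst_half) f = path_homotopic (f \o fst_half) (f \o id).
  by [].
apply: path_homotopic_reparam => //; first exact: fst_half_continuous.
- exact: cont_id.
- by apply: ival_inj; rewrite ival0 clamp_le0 // ival0 mulr0.
- by apply: ival_inj; rewrite ival1 clamp_ge1 // ival1; lra.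
Qed.

Lemma cat_cstl f x : continuous f -> f zero = x ->
  path_homotopic (cat_fun (fun=> x) f) f.
Proof.
move=> cf fx; have -> : cat_fun (fun=> x) f = f \o snd_half.
  apply/funext => t; rewrite /cat_fun; case: ifPn => // t2.
  rewrite -fx; congr f; apply: ival_inj; rewrite ival0 [RHS]clamp_le0 //; lra.
have -> : path_homotopic (f \o snd_half) f = path_homotopic (f \o snd_half) (f \o id).
  by [].
apply: path_homotopic_reparam => //; first exact: snd_half_continuous.
- exact: cont_id.
- by apply: ival_inj; rewrite ival0 clamp_le0 // ival0; lra.
- by apply: ival_inj; rewrite ival1 clamp_ge1 // ival1; lra.
Qed.

Lemma cat_revr f : continuous f ->
  path_homotopic (cat_fun f (f \o irev)) (fun=> f zero).
Proof.
move=> cf; pose p (t : I) : I := clamp (Num.min (2 * ival t) (2 - 2 * ival t)).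
have cp : continuous p.
  apply: cont_clamp; apply: cont_min; last apply: cont_sub; try exact: cont_cst.
    by apply: cont_mul; [apply: cont_cst | apply: ival_continuous].
  by apply: cont_mul; [apply: cont_cst | apply: ival_continuous].
have -> : cat_fun f (f \o irev) = f \o p.
  apply/funext => t; rewrite /cat_fun /p /=; have /andP[t0 t1] := ivalP t.
  case: ifPn => [t2|]; last rewrite -ltNge => t2; congr f.
    by rewrite (min_idPl _) //; lra.
  rewrite (min_idPr _); last by lra.
  apply: ival_inj; rewrite ival_rev /snd_half !clampE; first lra.
    by apply/andP; split; lra.
  by apply/andP; split; lra.
change (path_homotopic (f \o p) (f \o fun=> zero)).
apply: path_homotopic_reparam => //; first exact: cont_cst.
- by apply: ival_inj; rewrite ival0 clamp_le0 // ge_min ival0; apply/orP; left; lra.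
- by apply: ival_inj; rewrite ival0 clamp_le0 // ge_min ival1; apply/orP; right; lra.
Qed.

Lemma irevK : involutive irev.
Proof. by move=> t; apply: ival_inj; rewrite !ival_rev; lra. Qed.

Lemma cat_revl f : continuous f ->
  path_homotopic (cat_fun (f \o irev) f) (fun=> f one).
Proof.
move=> cf; have := @cat_revr (f \o irev) (cont_comp cf irev_continuous).
rewrite /comp irev0; congr (path_homotopic (cat_fun _ _) _).
by apply/funext => t; rewrite irevK.
Qed.

Lemma cat_assoc f g h : continuous f -> continuous g -> continuous h ->
    f one = g zero -> g one = h zero ->
  path_homotopic (cat_fun f (cat_fun g h)) (cat_fun (cat_fun f g) h).
Proof.
move=> cf cg ch fg gh.
pose p (t : I) : I := clamp (Num.min (2 * ival t)
  (Num.min (ival t + 4^-1) ((ival t + 1) / 2))).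
have cp : continuous p.
  apply: cont_clamp; apply: cont_min.
    by apply: cont_mul; [apply: cont_cst | apply: ival_continuous].
  apply: cont_min; first by apply: cont_add; [apply: ival_continuous | apply: cont_cst].
  apply: cont_mul; last exact: cont_cst.
  by apply: cont_add; [apply: ival_continuous | apply: cont_cst].
have p1 t : ival t <= 4^-1 -> ival (p t) = 2 * ival t.
  move=> t4; have /andP[t0 t1] := ivalP t.
  rewrite /p (min_idPl _); first by rewrite clampE //; apply/andP; split; lra.
  by rewrite le_min; apply/andP; split; lra.
have p2 t : 4^-1 <= ival t <= 2^-1 -> ival (p t) = ival t + 4^-1.
  move=> /andP[t4 t2].
  rewrite /p (min_idPr _); last by rewrite ge_min; apply/orP; left; lra.
  by rewrite (min_idPl _) ?clampE //; first apply/andP; first split; lra.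
have p3 t : 2^-1 <= ival t -> ival (p t) = (ival t + 1) / 2.
  move=> t2; have /andP[t0 t1] := ivalP t.
  rewrite /p (min_idPr _); last by rewrite ge_min; apply/orP; right; lra.
  by rewrite (min_idPr _) ?clampE //; first apply/andP; first split; lra.
have -> : cat_fun (cat_fun f g) h = cat_fun f (cat_fun g h) \o p.
  apply/funext => t; rewrite /comp /cat_fun; have /andP[t0 t1] := ivalP t.
  have [t2|t2] := leP (ival t) 2^-1.
    rewrite {1}/fst_half clampE; last by apply/andP; split; lra.
    have [t4|t4] := leP (2 * ival t) 2^-1.
      rewrite ifT; last by rewrite p1; lra.
      congr f; rewrite /fst_half p1; last by lra.
      by rewrite clampE //; apply/andP; split; lra.
    rewrite ifF; last by apply/negP; rewrite p2 ?(ltW t2) //; [lra|apply/andP; split; lra].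
    have pt : ival (p t) = ival t + 4^-1 by rewrite p2 //; apply/andP; split; lra.
    have st : ival (snd_half (p t)) = 2 * ival t - 2^-1.
      by rewrite clampE pt; [lra|apply/andP; split; lra].
    rewrite ifT; last by rewrite st; lra.
    have ft : ival (fst_half t) = 2 * ival t by rewrite clampE //; apply/andP; split; lra.
    congr g; transitivity (clamp (4 * ival t - 1) : I).
      by rewrite /snd_half ft; congr clamp; lra.
    by rewrite /fst_half st; congr clamp; lra.
  have pt := p3 _ (ltW t2).
  rewrite ifF; last by apply/negP; rewrite pt; lra.
  have st : ival (snd_half (p t)) = ival t.
    by rewrite clampE pt; [lra|apply/andP; split; lra].
  rewrite ifF; last by apply/negP; rewrite st; lra.
  by congr h; rewrite /snd_half -/(snd_half _) st.
have cK : continuous (cat_fun f (cat_fun g h)).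
  by do 2?[apply: cat_continuous => //]; rewrite cat0.
apply: (@path_homotopic_reparam _ id p) => //; first exact: cont_id.
- by apply: ival_inj; rewrite p1 ival0 ?mulr0 //; lra.
- by apply: ival_inj; rewrite p3 ival1 //; lra.
Qed.

End Homotopy.
Section PathOperations.
Context {R : realType} {T : topologicalType}.
Local Notation I := (unitI R).
Implicit Types x y z : T.

Definition path_of (f : I -> T) x y (cf : continuous f) (f0 : f zero = x)
    (f1 : f one = y) : {path I from x to y} := mk_path cf f0 f1.

Fact path_cont x y (p : {path I from x to y in T}) : continuous p.
Proof. exact: cts_fun. Qed.

Fact cat_path_cont x y z (p : {path I from x to y in T})
    (q : {path I from y to z in T}) : continuous (cat_fun p q).
Proof.
by apply: cat_continuous; rewrite ?path_one ?path_zero //; apply: path_cont.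
Qed.
Fact cat_path_zero x y z (p : {path I from x to y in T})
    (q : {path I from y to z in T}) : cat_fun p q zero = x.
Proof. by rewrite cat0 path_zero. Qed.
Fact cat_path_one x y z (p : {path I from x to y in T})
    (q : {path I from y to z in T}) : cat_fun p q one = z.
Proof. by rewrite cat1 path_one. Qed.

(* First p, then q: with this order of composition, B -> W is a morphism for the
   left action of W on C^n. *)
Definition path_cat x y z (p : {path I from x to y in T})
    (q : {path I from y to z in T}) : {path I from x to z in T} :=
  path_of (@cat_path_cont _ _ _ p q) (cat_path_zero p q) (cat_path_one p q).

Fact rev_path_cont x y (p : {path I from x to y in T}) : continuous (p \o irev).
Proof. by apply: cont_comp; [apply: path_cont | apply: irev_continuous]. Qed.
Fact rev_path_zero x y (p : {path I from x to y in T}) : (p \o irev) zero = y.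
Proof. by rewrite /= irev0 path_one. Qed.
Fact rev_path_one x y (p : {path I from x to y in T}) : (p \o irev) one = x.
Proof. by rewrite /= irev1 path_zero. Qed.

Definition path_rev x y (p : {path I from x to y in T}) : {path I from y to x in T} :=
  path_of (@rev_path_cont _ _ p) (rev_path_zero p) (rev_path_one p).

Definition path_cst x : {path I from x to x in T} :=
  path_of (@cont_cst I T x) erefl erefl.

End PathOperations.

Section PathImage.
Context {R : realType} {T U : topologicalType} (u : T -> U) (cu : continuous u).
Local Notation I := (unitI R).
Variables (x y : T) (p : {path I from x to y in T}).

Fact image_path_cont : continuous (u \o p).
Proof. by apply: cont_comp => //; apply: path_cont. Qed.
Fact image_path_zero : (u \o p) zero = u x. Proof. by rewrite /= path_zero. Qed.
Fact image_path_one : (u \o p) one = u y. Proof. by rewrite /= path_one. Qed.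

Definition path_image : {path I from u x to u y in U} :=
  path_of image_path_cont image_path_zero image_path_one.
End PathImage.

Section FundamentalGroup.
Context {R : realType} {T : topologicalType} (x : T).
Local Notation I := (unitI R).
Local Notation loop := {path I from x to x in T}.

Definition loop_rel (p q : loop) : bool := `[< path_homotopic p q >].

Fact loop_rel_refl : reflexive loop_rel.
Proof. by move=> p; apply/asboolP/path_homotopic_refl/path_cont. Qed.
Fact loop_rel_sym : symmetric loop_rel.
Proof.
by move=> p q; apply: asbool_equiv_eq; split; apply: path_homotopic_sym.
Qed.
Fact loop_rel_trans : transitive loop_rel.
Proof.
move=> q p r /asboolP pq /asboolP qr; apply/asboolP.
exact: path_homotopic_trans pq qr.
Qed.

Canonical loop_equiv := EquivRel loop_rel loop_rel_refl loop_rel_sym loop_rel_trans.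

Definition pi1 : Type := {eq_quot loop_equiv}.
HB.instance Definition _ := Choice.on pi1.
HB.instance Definition _ := EqQuotient.on pi1.

Definition loop_class (p : loop) : pi1 := \pi_pi1 p.

Lemma loop_class_eq (p q : loop) : path_homotopic p q <-> loop_class p = loop_class q.
Proof.
split=> [pq|/eqP]; last by rewrite eqmodE => /asboolP.
by apply/eqP; rewrite eqmodE; apply/asboolP.
Qed.

Lemma loop_repr (p : loop) :
  path_homotopic (generic_quotient.repr (loop_class p)) p.
Proof. by apply/loop_class_eq; rewrite /loop_class reprK. Qed.

Lemma pi1W (P : pi1 -> Prop) : (forall p, P (loop_class p)) -> forall a, P a.
Proof. by move=> Pp a; rewrite -[a]reprK; apply: Pp. Qed.

Definition pi1_one : pi1 := loop_class (path_cst x).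
Definition pi1_mul (a b : pi1) : pi1 :=
  loop_class (path_cat (generic_quotient.repr a) (generic_quotient.repr b)).
Definition pi1_inv (a : pi1) : pi1 := loop_class (path_rev (generic_quotient.repr a)).

Lemma pi1_mulE (p q : loop) :
  pi1_mul (loop_class p) (loop_class q) = loop_class (path_cat p q).
Proof.
apply/loop_class_eq/path_homotopic_cat; last 2 first.
- exact: loop_repr.
- exact: loop_repr.
by rewrite path_one path_zero.
Qed.

Lemma path_homotopic_rev (f g : I -> T) :
  path_homotopic f g -> path_homotopic (f \o irev) (g \o irev).
Proof.
case=> h [ch [h0 h1 hz ho]]; exists (fun st => h (st.1, irev st.2)); split.
  apply: (cont_comp ch); apply: pair_continuous; first exact: cont_fst.
  by apply: (cont_comp irev_continuous); apply: cont_snd.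
by split=> [t|t|s|s] /=; rewrite ?h0 ?h1 ?irev0 ?irev1.
Qed.

Lemma pi1_invE (p : loop) : pi1_inv (loop_class p) = loop_class (path_rev p).
Proof. exact/loop_class_eq/path_homotopic_rev/loop_repr. Qed.

Fact pi1_mulA : associative pi1_mul.
Proof.
elim/pi1W => p; elim/pi1W => q; elim/pi1W => r; rewrite !pi1_mulE.
by apply/loop_class_eq/cat_assoc; rewrite ?path_one ?path_zero //; apply: path_cont.
Qed.
Fact pi1_mul1l : left_id pi1_one pi1_mul.
Proof.
elim/pi1W => p; rewrite pi1_mulE; apply/loop_class_eq/cat_cstl.
  exact: path_cont.
exact: path_zero.
Qed.
Fact pi1_mul1r : right_id pi1_one pi1_mul.
Proof.
elim/pi1W => p; rewrite pi1_mulE; apply/loop_class_eq/cat_cstr.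
  exact: path_cont.
exact: path_one.
Qed.
Fact pi1_mulVl : left_inverse pi1_one pi1_inv pi1_mul.
Proof.
elim/pi1W => p; rewrite pi1_invE pi1_mulE; apply/loop_class_eq.
by have := cat_revl (@path_cont _ _ _ _ p); rewrite path_one.
Qed.
Fact pi1_mulVr : right_inverse pi1_one pi1_inv pi1_mul.
Proof.
elim/pi1W => p; rewrite pi1_invE pi1_mulE; apply/loop_class_eq.
by have := cat_revr (@path_cont _ _ _ _ p); rewrite path_zero.
Qed.

HB.instance Definition _ := isGroup.Build pi1
  pi1_mulA pi1_mul1l pi1_mul1r pi1_mulVl pi1_mulVr.

End FundamentalGroup.
Arguments pi1 R {T} x.
Section MatrixContinuity.
Context {K : numFieldType} {n : nat}.

Lemma coord_continuous (i : 'I_n) (j : 'I_1) : continuous (fun v : 'cV[K]_n => v i j).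
Proof.
move=> v A /= vA.
exists (fun i' j' => if (i' == i) && (j' == j) then A else setT).
  move=> i' j'; case: ifP => [/andP[/eqP -> /eqP ->]//|_]; exact: filterT.
by move=> u /(_ i j); rewrite !eqxx.
Qed.

Lemma mx_continuous (Z : topologicalType) (f : Z -> 'cV[K]_n) :
  (forall i j, continuous (fun z => f z i j)) -> continuous f.
Proof.
move=> cf z A [P Pf PA].
have zT : Filter (nbhs z) by apply: nbhs_filter.
suff : \forall x \near z, forall i j, P i j (f x i j).
  by apply: filterS => x Px; apply: PA.
by apply: filter_forall => i; apply: filter_forall => j; apply: cf (Pf i j).
Qed.

Lemma mulmx_continuous (M : 'M[K]_n) : continuous (fun v : 'cV[K]_n => M *m v).
Proof.
apply: mx_continuous => i j.
have -> : (fun v : 'cV[K]_n => (M *m v) i j) = (fun v => \sum_l M i l * v l j).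
  by apply/funext => v; rewrite mxE.
apply: continuous_big => [|l _]; first exact: add_continuous.
exact: (cont_comp (@mulrl_continuous K (M i l)) (@coord_continuous l j)).
Qed.
End MatrixContinuity.

Record reflection_group (R : realType) (n : nat) := ReflectionGroup {
  rg_sort :> finGroupType;
  rg_mx : mx_representation (Cx R) [set: rg_sort]%SET n;
  rg_faithful : mx_faithful rg_mx;
  rg_generated :
    <<[set s | \rank (rg_mx s - 1%:M) == 1%N]%SET>>%g = [set: rg_sort]%SET :> {set rg_sort}
}.

Section ReflectionGroup.
Context {R : realType} {n : nat} (W : reflection_group R n).
Local Notation V := 'cV[Cx R]_n.

Definition is_reflection (s : W) : bool := \rank (rg_mx W s - 1%:M) == 1%N.

(* Ker(s - 1) *)
Definition fixed_space (s : W) : set V := [set v | rg_mx W s *m v = v].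

(* The arrangement, as the finite type of the sets Ker(s - 1), s a reflection. *)
Definition hyperplanes : seq (set V) :=
  [seq fixed_space s | s <- enum W & is_reflection s].
Definition hyp : finType := seq_sub hyperplanes.
Definition hyp_set (H : hyp) : set V := ssval H.

Definition pointwise_stab (H : hyp) : {set W} :=
  [set w | `[< forall v, hyp_set H v -> rg_mx W w *m v = v >]]%SET.

Lemma rg_mxM (w w' : W) : rg_mx W (w * w')%g = rg_mx W w *m rg_mx W w'.
Proof. by rewrite repr_mxM ?inE. Qed.
Lemma rg_mxKV (w : W) : rg_mx W w *m rg_mx W w^-1%g = 1%:M.
Proof. by rewrite -rg_mxM mulgV repr_mx1. Qed.
Lemma rg_mxVK (w : W) : rg_mx W w^-1%g *m rg_mx W w = 1%:M.
Proof. by rewrite -rg_mxM mulVg repr_mx1. Qed.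

Fact pointwise_stab_group_set H : group_set (pointwise_stab H).
Proof.
apply/group_setP; split=> [|w w']; rewrite !inE.
  by apply/asboolP => v _; rewrite repr_mx1 mul1mx.
move=> /asboolP fw /asboolP fw'; apply/asboolP => v Hv.
by rewrite rg_mxM -mulmxA fw' // fw.
Qed.
Canonical pointwise_stab_group H : {group W} := Group (pointwise_stab_group_set H).

Definition hyp_order (H : hyp) : nat := #|pointwise_stab H|.

Definition distinguished (H : hyp) (s : W) : Prop :=
  s \in pointwise_stab H /\
  eigenvalue (rg_mx W s) (expi (2 * pi / (hyp_order H)%:R)).

Lemma fixed_spaceJ (w s : W) :
  fixed_space (w * s * w^-1)%g = [set rg_mx W w *m v | v in fixed_space s].
Proof.
apply/seteqP; split=> [v /= sv|_ [v /= sv <-]].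
  exists (rg_mx W w^-1%g *m v); last by rewrite mulmxA rg_mxKV mul1mx.
  rewrite /fixed_space /= in sv *.
  by rewrite -[in RHS]sv !rg_mxM !mulmxA rg_mxVK mul1mx.
rewrite /fixed_space /= in sv *.
by rewrite !rg_mxM -!mulmxA (mulmxA (rg_mx W w^-1%g)) rg_mxVK mul1mx sv.
Qed.

Lemma is_reflectionJ (w s : W) : is_reflection (w * s * w^-1)%g = is_reflection s.
Proof.
rewrite /is_reflection !rg_mxM.
have -> : rg_mx W w *m rg_mx W s *m rg_mx W w^-1%g - 1%:M =
    rg_mx W w *m (rg_mx W s - 1%:M) *m rg_mx W w^-1%g.
  by rewrite mulmxBr mulmxBl mulmx1 rg_mxKV.
have uw w' : rg_mx W w' \in unitmx by apply: repr_mx_unit; rewrite inE.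
rewrite mxrankMfree ?row_free_unit //.
by rewrite -mxrank_tr trmx_mul mxrankMfree ?mxrank_tr // row_free_unit unitmx_tr.
Qed.

Lemma hypP (H : set V) :
  reflect (exists2 s, is_reflection s & H = fixed_space s) (H \in hyperplanes).
Proof.
apply: (iffP mapP) => [[s]|[s rs ->]].
  by rewrite mem_filter => /andP[rs _] ->; exists s.
by exists s; rewrite // mem_filter rs mem_enum.
Qed.

Fact hyp_act_subproof (w : W) (H : hyp) :
  [set rg_mx W w *m v | v in hyp_set H] \in hyperplanes.
Proof.
have /hypP[s rs Hs] := ssvalP H.
apply/hypP; exists (w * s * w^-1)%g; first by rewrite is_reflectionJ.
by rewrite fixed_spaceJ /hyp_set Hs.
Qed.

Definition hyp_act (w : W) (H : hyp) : hyp := SeqSub (hyp_act_subproof w H).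

Definition regular (v : V) : bool := [forall H : hyp, ~~ `[< hyp_set H v >]].
Definition complement : topologicalType :=
  initial_topology (val : {v : V | regular v} -> V).

Definition cval (v : complement) : V := val (v : {v : V | regular v}).

Lemma cval_inj : injective cval. Proof. exact: val_inj. Qed.

Lemma regularP (v : V) : reflect (forall H, ~ hyp_set H v) (regular v).
Proof.
apply: (iffP forallP) => vH H; first by move=> /asboolP; apply/negP.
by apply/negP => /asboolP; apply: vH.
Qed.

Fact act_subproof (w : W) (v : complement) : regular (rg_mx W w *m cval v).
Proof.
apply/regularP => H wv; have /regularP/(_ (hyp_act w^-1%g H)) := valP (v : {v : V | regular v}); apply.
by exists (rg_mx W w *m cval v); rewrite // mulmxA rg_mxVK mul1mx.
Qed.

Definition act (w : W) (v : complement) : complement :=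
  exist _ (rg_mx W w *m cval v) (act_subproof w v).

Lemma cval_act w v : cval (act w v) = rg_mx W w *m cval v. Proof. by []. Qed.

Lemma act1 v : act 1%g v = v.
Proof. by apply: cval_inj; rewrite cval_act repr_mx1 mul1mx. Qed.
Lemma actM w w' v : act (w * w')%g v = act w (act w' v).
Proof. by apply: cval_inj; rewrite !cval_act rg_mxM mulmxA. Qed.

Definition orbit_rel (v v' : complement) : bool := [exists w : W, v' == act w v].
Fact orbit_rel_refl : reflexive orbit_rel.
Proof. by move=> v; apply/existsP; exists 1%g; rewrite act1. Qed.
Fact orbit_rel_sym : symmetric orbit_rel.
Proof.
by move=> v v'; apply/existsP/existsP => -[w /eqP ->]; exists w^-1%g;
  rewrite -actM mulVg act1.
Qed.
Fact orbit_rel_trans : transitive orbit_rel.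
Proof.
move=> v' v v'' /existsP[w /eqP ->] /existsP[w' /eqP ->].
by apply/existsP; exists (w' * w)%g; rewrite actM.
Qed.
Canonical orbit_equiv :=
  EquivRel orbit_rel orbit_rel_refl orbit_rel_sym orbit_rel_trans.

Definition orbit_space : topologicalType := quotient_topology {eq_quot orbit_equiv}.
Definition orbit_proj (v : complement) : orbit_space :=
  \pi_(quotient_topology {eq_quot orbit_equiv}) v.

Lemma orbit_proj_continuous : continuous orbit_proj.
Proof. exact: pi_continuous. Qed.

Lemma orbit_projP v v' : orbit_proj v = orbit_proj v' <-> exists w, v' = act w v.
Proof.
rewrite /orbit_proj; split=> [/(@eqmodP _ orbit_equiv)/existsP[w /eqP ->]|[w ->]].
  by exists w.
by apply/(@eqmodP _ orbit_equiv); apply/existsP; exists w.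
Qed.

Lemma act_continuous w : continuous (act w).
Proof.
apply: continuous_comp_initial.
apply: (@cont_comp _ _ _ (mulmx (rg_mx W w)) cval); last exact: initial_continuous.
exact: mulmx_continuous.
Qed.

End ReflectionGroup.
Section PointwiseStabilizer.
Context {R : realType} {n : nat} {W : reflection_group R n}.

Lemma fixed_spaceE (s : W) (v : 'cV[Cx R]_n) :
  fixed_space s v <-> (v^T <= kermx (rg_mx W s - 1%:M)^T)%MS.
Proof.
have -> : (v^T <= kermx (rg_mx W s - 1%:M)^T)%MS = ((rg_mx W s - 1%:M) *m v == 0).
  by rewrite sub_kermx -trmx_mul -(inj_eq trmx_inj) trmxK trmx0.
rewrite mulmxBl mul1mx subr_eq0; split=> [->//|/eqP //].
Qed.

Lemma pointwise_stab_reflection (H : hyp W) (t s : W) :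
    is_reflection t -> fixed_space t = hyp_set H -> s \in pointwise_stab H ->
  s = 1%g \/ is_reflection s /\ fixed_space s = hyp_set H.
Proof.
rewrite inE => rt tH /asboolP sH.
set A := kermx (rg_mx W t - 1%:M)^T; set B := kermx (rg_mx W s - 1%:M)^T.
have AB : (A <= B)%MS.
  apply/rV_subP => u uA; rewrite -[u]trmxK; apply/fixed_spaceE/sH.
  by rewrite -tH; apply/fixed_spaceE; rewrite trmxK.
have rA : \rank A = (n - 1)%N by rewrite mxrank_ker mxrank_tr (eqP rt).
have rB : \rank B = (n - \rank (rg_mx W s - 1%:M)%R)%N by rewrite mxrank_ker mxrank_tr.
have n0 : (0 < n)%N by have := rank_leq_row (rg_mx W t - 1%:M); rewrite (eqP rt).
have := mxrankS AB; rewrite rA rB => le.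
have rs1 : (\rank (rg_mx W s - 1%:M)%R <= 1)%N.
  have := rank_leq_row (rg_mx W s - 1%:M); move: le; lia.
have [rs0|rs0] := eqVneq (\rank (rg_mx W s - 1%:M)) 0%N.
  left; apply/finset.set1P; apply: (fintype.subsetP (rg_faithful W)); apply/rkerP; split.
    by rewrite inE.
  by apply/eqP; rewrite -subr_eq0 -mxrank_eq0 rs0.
have rs : \rank (rg_mx W s - 1%:M) = 1%N by apply/eqP; rewrite eqn_leq rs1 lt0n.
right; split; first by rewrite /is_reflection rs.
have BA : (B <= A)%MS by rewrite -(geq_leqif (mxrank_leqif_sup AB)) rA rB rs.
rewrite -tH; apply/seteqP; split=> v /fixed_spaceE vk; apply/fixed_spaceE.
  exact: submx_trans vk BA.
exact: submx_trans vk AB.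
Qed.
End PointwiseStabilizer.

Section BraidGroup.
Context {R : realType} {n : nat} {W : reflection_group R n} (x0 : complement W).
Local Notation I := (unitI R).
Local Notation V := 'cV[Cx R]_n.

Definition braid : groupType := pi1 R (orbit_proj x0).

Section BraidClass.
Variables (w : W) (p : {path I from x0 to (act w x0) in complement W}).

Fact braid_loop_cont : continuous (@orbit_proj _ _ W \o p).
Proof. by apply: cont_comp; [apply: orbit_proj_continuous | apply: path_cont]. Qed.
Fact braid_loop_zero : (@orbit_proj _ _ W \o p) zero = orbit_proj x0.
Proof. by rewrite /= path_zero. Qed.
Fact braid_loop_one : (@orbit_proj _ _ W \o p) one = orbit_proj x0.
Proof. by rewrite /= path_one; apply/esym/orbit_projP; exists w. Qed.

(* The class in B of a path from x0 to w(x0) in the complement. *)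
Definition braid_class : braid :=
  loop_class (path_of braid_loop_cont braid_loop_zero braid_loop_one).
End BraidClass.

(* y = p + u with p in H and u in the eigenline of s transverse to H. That the
   whole disk p + zu, |z| <= 1, avoids the other hyperplanes expresses that p is
   generic in H and that y is close to p. The path c is the rotation from y to s(y). *)
Definition braided_reflection (H : hyp W) (sigma : braid) : Prop :=
  exists (s : W) (y : complement W)
    (gamma : {path I from x0 to y in complement W})
    (c : {path I from y to (act s y) in complement W}) (p u : V),
  [/\ distinguished H s,
      [/\ hyp_set H p, rg_mx W s *m u = expi (2 * pi / (hyp_order H)%:R) *: u
        & cval y = p + u],
      forall (z : Cx R) (H' : hyp W),
        `|z| <= 1 -> H' != H -> ~ hyp_set H' (p + z *: u),
      forall t, cval (c t) = p + expi (2 * pi * ival t / (hyp_order H)%:R) *: u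
    & sigma = braid_class (path_cat (path_cat gamma c)
                (path_rev (path_image (@act_continuous _ _ W s) gamma)))].

(* The projection B -> W is determined by its values on the classes of the paths
   from x0 to w(x0), because every loop in the orbit space lifts to such a path. *)
Record natural_projection := NaturalProjection {
  np_fun :> {multiplicative braid -> W};
  np_path : forall w (p : {path I from x0 to (act w x0) in complement W}),
    np_fun (braid_class p) = w
}.

Lemma np_braided (pi : natural_projection) H sigma :
  braided_reflection H sigma -> distinguished H (pi sigma).
Proof. by case=> s [y [g [c [p [u [ds _ _ _ ->]]]]]]; rewrite np_path. Qed.

End BraidGroup.

Section AdmissibleLattice.
Context {R : realType} {n : nat} (W : reflection_group R n).

Definition full_reflection_subgroup (x : {group W}) : Prop :=
  <<[set s in x | is_reflection s]%SET>>%g = x /\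
  forall s t : W, is_reflection s -> is_reflection t ->
    fixed_space t = fixed_space s -> s \in x -> t \in x.

Definition is_lub (L : {set {group W}}) (x y z : {group W}) : bool :=
  [&& z \in L, x \subset z, y \subset z &
      [forall t : {group W}, (t \in L) ==> (x \subset t) ==> (y \subset t) ==>
                             (z \subset t)]].

Record admissible_lattice := AdmissibleLattice {
  al_set : {set {group W}};
  al_full : forall x, x \in al_set -> full_reflection_subgroup x;
  al_lub : forall x y, x \in al_set -> y \in al_set -> exists z, is_lub al_set x y z;
  al_conj : forall x (w : W), x \in al_set -> (x :^ w)%G \in al_set;
  al_trivial : 1%G \in al_set;
  al_cyclic : forall H, pointwise_stab_group H \in al_set
}.

Definition hyp_in (H : hyp W) (x : {group W}) : Prop :=
  exists s : W, [/\ s \in x, is_reflection s & fixed_space s = hyp_set H].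

Variable L : admissible_lattice.

Definition lat : Type := {x : {group W} | x \in al_set L}.
HB.instance Definition _ := Finite.copy lat {x : {group W} | x \in al_set L}.
Definition lat_group (x : lat) : {group W} := val (x : {x : {group W} | x \in al_set L}).

Lemma lat_groupP (x : lat) : lat_group x \in al_set L.
Proof. exact: (valP (x : {x : {group W} | x \in al_set L})). Qed.
Lemma lat_inj : injective lat_group. Proof. exact: val_inj. Qed.

Fact lat_join_subproof (x y : lat) : exists z : lat,
  is_lub (al_set L) (lat_group x) (lat_group y) (lat_group z).
Proof.
have [z zP] := al_lub (lat_groupP x) (lat_groupP y).
by have /and4P[zL _ _ _] := zP; exists (exist _ z zL).
Qed.
Definition lat_join (x y : lat) : lat := xchoose (lat_join_subproof x y).
Definition lat_one : lat := exist _ 1%G (al_trivial L).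
Definition lat_hyp (H : hyp W) : lat := exist _ (pointwise_stab_group H) (al_cyclic L H).

Lemma lat_joinP (x y z : lat) :
  (lat_group (lat_join x y) \subset lat_group z) =
    (lat_group x \subset lat_group z) && (lat_group y \subset lat_group z).
Proof.
have /and4P[_ xz yz /forallP H] := xchooseP (lat_join_subproof x y).
apply/idP/andP => [jz|[xz' yz']].
  by rewrite (fintype.subset_trans xz jz) (fintype.subset_trans yz jz).
by have := H (lat_group z); rewrite lat_groupP xz' yz'.
Qed.

Lemma lat_eqP (x y : lat) :
  (forall z, (lat_group x \subset lat_group z) = (lat_group y \subset lat_group z)) ->
  x = y.
Proof.
move=> xy; apply/lat_inj/val_inj/eqP; rewrite finset.eqEsubset.
by rewrite xy fintype.subxx -xy fintype.subxx.
Qed.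

Fact lat_joinA : associative lat_join.
Proof. by move=> x y z; apply: lat_eqP => t; rewrite !lat_joinP andbA. Qed.
Fact lat_join1l : left_id lat_one lat_join.
Proof. by move=> x; apply: lat_eqP => t; rewrite lat_joinP sub1G. Qed.
Fact lat_join1r : right_id lat_one lat_join.
Proof. by move=> x; apply: lat_eqP => t; rewrite lat_joinP sub1G andbT. Qed.

Fact lat_act_subproof (w : W) (x : lat) : (lat_group x :^ w^-1)%G \in al_set L.
Proof. by apply: al_conj; apply: lat_groupP. Qed.

Definition lat_act (w : W) (x : lat) : lat :=
  exist _ (lat_group x :^ w^-1)%G (lat_act_subproof w x).

Lemma lat_group_act w x : lat_group (lat_act w x) = (lat_group x :^ w^-1)%g :> {set W}.
Proof. by []. Qed.
Lemma lat_act1 x : lat_act 1%g x = x.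
Proof. by apply/lat_inj/val_inj; rewrite /= invg1 conjsg1. Qed.
Lemma lat_actM w w' x : lat_act (w * w')%g x = lat_act w (lat_act w' x).
Proof. by apply/lat_inj/val_inj; rewrite /= invMg conjsgM. Qed.
Lemma lat_act_one w : lat_act w lat_one = lat_one.
Proof. by apply/lat_inj/val_inj; rewrite /= conjs1g. Qed.
Lemma lat_act_sub w (x y : lat) :
  (lat_group (lat_act w x) \subset lat_group y) =
  (lat_group x \subset lat_group (lat_act w^-1 y)).
Proof. by rewrite !lat_group_act invgK sub_conjgV. Qed.
Lemma lat_act_join w x y : lat_act w (lat_join x y) = lat_join (lat_act w x) (lat_act w y).
Proof.
apply: lat_eqP => t.
by rewrite lat_act_sub !lat_joinP !lat_act_sub.
Qed.

Definition lat_orbit (x : lat) : {set lat} := [set lat_act w x | w : W]%SET.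

Definition lat_orbits : finType :=
  {X : {set lat} | X \in [set lat_orbit x | x : lat]%SET}.

End AdmissibleLattice.
Section ParameterRing.
Context {R : realType} {n : nat} (W : reflection_group R n).

(* The pairs (H, i) with 0 <= i < m_H, and their classes under (H, i) ~ (w(H), i). *)
Definition param : finType := {H : hyp W & 'I_(hyp_order H)}.

Definition param_class (p : param) : {set param} :=
  [set q : param | [exists w : W, tag q == hyp_act w (tag p)] &&
                   (tagged q == tagged p :> nat)]%SET.
Definition param_classes : finType :=
  {c : {set param} | c \in [set param_class p | p : param]%SET}.

Fact param_var_subproof (p : param) :
  param_class p \in [set param_class q | q : param]%SET.
Proof. exact: imset_f. Qed.
Definition param_var (p : param) : param_classes :=
  exist _ (param_class p) (param_var_subproof p).

Lemma hyp_act1 (H : hyp W) : hyp_act 1%g H = H.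
Proof.
apply: val_inj; rewrite /= repr_mx1; apply/seteqP; split=> [_ [v Hv <-]|v Hv].
  by rewrite mul1mx.
by exists v; rewrite ?mul1mx.
Qed.

Lemma hyp_actM (w w' : W) (H : hyp W) : hyp_act (w * w')%g H = hyp_act w (hyp_act w' H).
Proof.
apply: val_inj; rewrite /= rg_mxM; apply/seteqP; split=> [_ [v Hv <-]|_ [_ [v Hv <-] <-]].
  by exists (rg_mx W w' *m v); [exists v | rewrite mulmxA].
by exists v; rewrite // mulmxA.
Qed.

Lemma param_class_refl p : p \in param_class p.
Proof.
by rewrite inE eqxx andbT; apply/existsP; exists 1%g; rewrite hyp_act1.
Qed.

Lemma param_class_eq p q : q \in param_class p -> param_class q = param_class p.
Proof.
rewrite inE => /andP[/existsP[w /eqP qp] /eqP qpi]; apply/setP => r; rewrite !inE.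
rewrite qpi; congr (_ && _); rewrite qp.
apply/existsP/existsP => -[w' /eqP ->].
  by exists (w' * w)%g; rewrite hyp_actM.
by exists (w' * w^-1)%g; rewrite -hyp_actM -mulgA mulVg mulg1.
Qed.

Lemma param_var_index p q : param_var p = param_var q -> tagged p = tagged q :> nat.
Proof.
move=> /(congr1 val)/= pq; have := param_class_refl p.
by rewrite pq inE => /andP[_ /eqP].
Qed.

(* The Laurent monomials: only the classes of the a_{H,0} may have a negative
   exponent. *)
Definition laurent_exponent (e : {ffun param_classes -> int}) : bool :=
  [forall p : param, (0 < tagged p)%N ==> (0 <= e (param_var p))].

Record laurent_monomial :=
  LaurentMonomial { lm_exp : {ffun param_classes -> int}; _ : laurent_exponent lm_exp }.
HB.instance Definition _ := [isSub for lm_exp].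
HB.instance Definition _ := [Choice of laurent_monomial by <:].

Lemma lm_expP e : laurent_exponent (lm_exp e). Proof. exact: valP e. Qed.

Fact lm_one_subproof : laurent_exponent 0.
Proof. by apply/forallP => p; rewrite ffunE lexx implybT. Qed.
Definition lm_one := LaurentMonomial lm_one_subproof.
Fact lm_mul_subproof (e f : laurent_monomial) : laurent_exponent (lm_exp e + lm_exp f).
Proof.
apply/forallP => p; apply/implyP => p0; rewrite ffunE.
have /forallP/(_ p) := lm_expP e; have /forallP/(_ p) := lm_expP f.
by rewrite p0 /= => f0 e0; apply: addr_ge0.
Qed.
Definition lm_mul (e f : laurent_monomial) := LaurentMonomial (lm_mul_subproof e f).

Fact lm_mulA : associative lm_mul.
Proof. by move=> e f g; apply: val_inj; rewrite /= addrA. Qed.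
Fact lm_mulC : commutative lm_mul.
Proof. by move=> e f; apply: val_inj; rewrite /= addrC. Qed.
Fact lm_mul1l : left_id lm_one lm_mul.
Proof. by move=> e; apply: val_inj; rewrite /= add0r. Qed.
Fact lm_mul1r : right_id lm_one lm_mul.
Proof. by move=> e; rewrite lm_mulC lm_mul1l. Qed.

HB.instance Definition _ := isMonoid.Build laurent_monomial lm_mulA lm_mul1l lm_mul1r.

Definition laurent : Type := monalg int laurent_monomial.
HB.instance Definition _ := GRing.PzRing.on laurent.

Fact laurent_mulC : commutative (@GRing.mul laurent).
Proof.
move=> f g; elim/(@monalg_ind int laurent_monomial): f => [|f f' IH IH'|c a].
- by rewrite mulr0 mul0r.
- by rewrite mulrDl mulrDr IH IH'.
elim/(@monalg_ind int laurent_monomial): g => [|g g' IH IH'|d b].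
- by rewrite mulr0 mul0r.
- by rewrite mulrDl mulrDr IH IH'.
by rewrite [LHS]singleM [RHS]singleM mulrC; congr single; apply: lm_mulC.
Qed.
HB.instance Definition _ := GRing.PzRing_hasCommutativeMul.Build laurent laurent_mulC.

Fact lm_var_subproof (c : param_classes) :
  laurent_exponent [ffun d => (d == c)%:Z].
Proof. by apply/forallP => p; apply/implyP => _; rewrite ffunE. Qed.

Definition a_ (H : hyp W) (i : 'I_(hyp_order H)) : laurent :=
  mono (LaurentMonomial (lm_var_subproof (param_var (Tagged _ i)))).

Fact hyp_order_gt0 (H : hyp W) : (0 < hyp_order H)%N.
Proof. exact: cardG_gt0. Qed.

Definition ord_zero (H : hyp W) : 'I_(hyp_order H) := Ordinal (hyp_order_gt0 H).

Fact lm_inv_subproof (H : hyp W) :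
  laurent_exponent [ffun d => - (d == param_var (Tagged _ (ord_zero H)))%:Z].
Proof.
apply/forallP => p; apply/implyP => p0; rewrite ffunE.
by case: eqP => [/param_var_index pH|_]; rewrite ?oppr0 //; rewrite pH in p0.
Qed.

Definition a0inv (H : hyp W) : laurent := mono (LaurentMonomial (lm_inv_subproof H)).

Lemma a_a0inv (H : hyp W) : a_ (ord_zero H) * a0inv H = 1.
Proof.
rewrite [LHS]singleM mulr1; congr single; apply: val_inj; apply/ffunP => c.
by rewrite /= !ffunE subrr.
Qed.

Lemma a_conj (H : hyp W) (w : W) (i : 'I_(hyp_order H))
    (j : 'I_(hyp_order (hyp_act w H))) : i = j :> nat -> a_ i = a_ j.
Proof.
move=> ij; rewrite /a_; congr mono; apply: val_inj => /=.
rewrite (_ : param_var (Tagged _ j) = param_var (Tagged _ i)) //.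
apply/val_inj/param_class_eq; rewrite inE /= ij eqxx andbT.
by apply/existsP; exists w.
Qed.

Lemma hyp_order_act (H : hyp W) (w : W) : hyp_order (hyp_act w H) = hyp_order H.
Proof.
rewrite /hyp_order -(cardJg (pointwise_stab H) w^-1); congr #|pred_of_set _|.
apply/setP => s; rewrite mem_conjgV !inE; apply/asboolP/asboolP => fs v Hv.
  rewrite conjgE !rg_mxM -!mulmxA fs; last by exists v.
  by rewrite mulmxA rg_mxVK mul1mx.
have [u Hu <-] := Hv; have := fs u Hu; rewrite conjgE !rg_mxM -!mulmxA => su.
by rewrite -[in RHS]su !mulmxA rg_mxKV mul1mx.
Qed.

Definition laurent_gens (x : {group W}) : set laurent :=
  [set a | exists H, hyp_in H x /\ (exists i : 'I_(hyp_order H), a = a_ i)]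
  `|` [set a | exists H, hyp_in H x /\ a = a0inv H].

Definition laurent_sub (x : {group W}) : comPzRingType := subring_of (laurent_gens x).

Fact a_in_subproof (x : {group W}) H (i : 'I_(hyp_order H)) :
  hyp_in H x -> a_ i \in gen_subring (laurent_gens x).
Proof. by move=> Hx; apply: gen_subring_mem; left; exists H; split; [|exists i]. Qed.
Definition a_in (x : {group W}) H (Hx : hyp_in H x) (i : 'I_(hyp_order H)) :
  laurent_sub x := SubringOf (a_in_subproof i Hx).

End ParameterRing.

Section Algebras.
Context {R : realType} {n : nat} {W : reflection_group R n} {x0 : complement W}.
Variables (pi : natural_projection x0) (L : admissible_lattice W).

Lemma np1 : pi 1%g = 1%g.
Proof. by apply: (mulgI (pi 1%g)); rewrite -gmulfM !mulg1. Qed.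
Lemma npV b : pi b^-1%g = (pi b)^-1%g.
Proof. by apply: (mulgI (pi b)); rewrite -gmulfM !mulgV np1. Qed.
Lemma npX b i : pi (b ^+ i)%g = (pi b ^+ i)%g.
Proof. by elim: i => [|i IH]; rewrite ?np1 // !expgS gmulfM IH. Qed.

Section HeckeAlgebra.
Variable x : lat L.

Definition in_hatB (b : braid x0) : bool := lat_act (pi b) x == x.

Fact in_hatB_closed : group_closed in_hatB.
Proof.
split=> [|b c]; first by rewrite unfold_in np1 lat_act1.
rewrite !unfold_in => /eqP bx /eqP cx; rewrite gmulfM npV lat_actM.
suff -> : lat_act (pi c)^-1%g x = x by rewrite bx.
by rewrite -[in LHS]cx -lat_actM mulVg lat_act1.
Qed.

Record hatB := HatB { hatB_val : braid x0; _ : hatB_val \in in_hatB }.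
HB.instance Definition _ := [isSub for hatB_val].
HB.instance Definition _ := [Choice of hatB by <:].
HB.instance Definition _ :=
  SubChoice_isSubGroup.Build (braid x0) in_hatB hatB in_hatB_closed.

Local Notation Rx := (laurent_sub (lat_group x)).
Local Notation RxB := (monalg Rx hatB).

Definition hecke_rel : set RxB :=
  [set z | exists (H : hyp W) (Hx : hyp_in H (lat_group x)) (t : hatB),
     braided_reflection H (hatB_val t) /\
     z = mono t ^+ hyp_order H
         - \sum_(i < hyp_order H) alg_of (a_in Hx i) * mono t ^+ i]
  `|` [set z | exists (H : hyp W) (sigma : braid x0) (t : hatB),
     [/\ ~ hyp_in H (lat_group x), braided_reflection H sigma,
         hatB_val t = (sigma ^+ hyp_order H)%g & z = mono t - 1]].

Definition hecke : algOver Rx := quot hecke_rel.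

Lemma braided_in_hatB H sigma :
  hyp_in H (lat_group x) -> braided_reflection H sigma -> sigma \in in_hatB.
Proof.
move=> Hx /(np_braided pi)[sH _]; rewrite unfold_in.
suff sx : pi sigma \in lat_group x.
  by apply/eqP/lat_inj/val_inj; rewrite /= conjGid ?groupV.
have [t [tx rt tH]] := Hx; have [-> |[rs sfix]] := pointwise_stab_reflection rt tH sH.
  exact: group1.
by have [_ H'] := al_full (lat_groupP x); apply: (H' t) => //; rewrite sfix tH.
Qed.

Lemma braided_pow_in_hatB H sigma :
  braided_reflection H sigma -> (sigma ^+ hyp_order H)%g \in in_hatB.
Proof.
move=> /(np_braided pi)[sH _]; rewrite unfold_in npX.
by rewrite (expg_cardG (G := pointwise_stab_group H) sH) lat_act1.
Qed.

Variables (k : comPzRingType) (phi : {rmorphism laurent W -> k}).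

Definition laurent_sub_map : Rx -> k := phi \o @subring_val _ _.
Fact laurent_sub_map_zmod : zmod_morphism laurent_sub_map.
Proof. by move=> a b; rewrite /laurent_sub_map /= -[RHS]rmorphB. Qed.
Fact laurent_sub_map_monoid : GRing.monoid_morphism laurent_sub_map.
Proof.
by split=> [|a b]; rewrite /laurent_sub_map /= -?[RHS]rmorphM -?[RHS](rmorph1 phi).
Qed.
HB.instance Definition _ :=
  GRing.isZmodMorphism.Build Rx k laurent_sub_map laurent_sub_map_zmod.
HB.instance Definition _ :=
  GRing.isMonoidMorphism.Build Rx k laurent_sub_map laurent_sub_map_monoid.

Definition hecke_base_change : algOver k := base_change laurent_sub_map hecke.

End HeckeAlgebra.

(* The monoid L x B with (x, b) (y, c) = (x \/ b(y), bc), so that kB \ltimes kL is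
   its monoid algebra: (x, b) is the element e_x b. *)
Definition skew_monoid : Type := (lat L * braid x0)%type.
HB.instance Definition _ := Choice.copy skew_monoid (lat L * braid x0)%type.

Definition skew_one : skew_monoid := (lat_one L, 1%g).
Definition skew_mul (p q : skew_monoid) : skew_monoid :=
  (lat_join p.1 (lat_act (pi p.2) q.1), (p.2 * q.2)%g).

Fact skew_mulA : associative skew_mul.
Proof.
move=> p q r; rewrite /skew_mul /= mulgA lat_act_join lat_joinA gmulfM.
by rewrite lat_actM.
Qed.
Fact skew_mul1l : left_id skew_one skew_mul.
Proof. by case=> x b; rewrite /skew_mul /= np1 lat_act1 lat_join1l mul1g. Qed.
Fact skew_mul1r : right_id skew_one skew_mul.
Proof. by case=> x b; rewrite /skew_mul /= lat_act_one lat_join1r mulg1. Qed.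
HB.instance Definition _ := isMonoid.Build skew_monoid skew_mulA skew_mul1l skew_mul1r.

Section GeneralizedAlgebra.
Variables (k : comPzRingType) (phi : {rmorphism laurent W -> k}).
Local Notation kBL := (monalg k skew_monoid).

Definition of_braid (b : braid x0) : kBL := mono ((lat_one L, b) : skew_monoid).
Definition of_lat (x : lat L) : kBL := mono ((x, 1%g) : skew_monoid).

Lemma of_braid_lat b x :
  of_braid b * of_lat x = of_lat (lat_act (pi b) x) * of_braid b.
Proof.
rewrite [LHS]singleM [RHS]singleM; congr (single _ (_, _)) => /=.
  by rewrite np1 lat_act1 lat_join1l lat_join1r.
by rewrite mulg1 mul1g.
Qed.

(* The sum minus 1 is Q_s(sigma). *)
Definition C_rel : set kBL :=
  [set z | exists (H : hyp W) (sigma : braid x0), braided_reflection H sigma /\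
     z = of_braid sigma ^+ hyp_order H - 1
         - (\sum_(i < hyp_order H) alg_of (phi (a_ i)) * of_braid sigma ^+ i - 1)
           * of_lat (lat_hyp L H)].

Definition C_algebra : algOver k := quot C_rel.

End GeneralizedAlgebra.

End Algebras.

(* Main.v *)
(* The span of the e_l is split by the Moebius idempotents eps_x, the solutions of
   e_x = sum of the eps_y over y >= x; they satisfy e_l eps_x = eps_x if l <= x and 0
   otherwise, are orthogonal with sum 1, and b eps_x b^-1 = eps_(pi(b) x). Multiplied
   by eps_x, the relation of C for a braided reflection around H becomes the Hecke
   relation if H is in x and sigma^m = 1 if not, so that eps_x C eps_x is k H~_x, and the
   orbit X contributes the matrix block of the eps_x, x in X.
   Matrix units come from elements u_y of B with pi(u_y) y = x_*, and b is sent to the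
   matrix with entries u_(pi(b) y) b u_y^-1 at (pi(b) y, y). The u_y exist, and can be taken
   to be classes of paths, because the complement of the arrangement is path connected;
   for such classes u, u sigma u^-1 is visibly a braided reflection when sigma is. *)
From HB Require Import structures.
From mathcomp Require Import all_boot all_order all_algebra all_fingroup all_solvable all_character.
From mathcomp Require Import finmap complex ring lra.
From mathcomp Require Import all_classical all_reals all_analysis homotopy.
Require Import Defs.

Set Implicit Arguments.
Unset Strict Implicit.
Unset Printing Implicit Defensive.

Import Order.TTheory GRing.Theory Num.Theory.
Import numFieldNormedType.Exports.

Local Open Scope classical_set_scope.
Local Open Scope ring_scope.

(** * Paths in the complement of the arrangement *)

Section ContinuousArithmetic.
Context {K : numFieldType} {Z : topologicalType}.
Implicit Types g h : Z -> K.

Lemma continuous_addK g h : continuous g -> continuous h -> continuous (fun z => g z + h z).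
Proof. by move=> cg ch z; apply: cvgD; [apply: cg|apply: ch]. Qed.

Lemma continuous_mulK g h : continuous g -> continuous h -> continuous (fun z => g z * h z).
Proof. by move=> cg ch z; apply: cvgM; [apply: cg|apply: ch]. Qed.
End ContinuousArithmetic.

Section PathConnected.
Context {R : realType} {n : nat} {W : reflection_group R n}.
Local Notation I := (unitI R).

Lemma real_complex_continuous : continuous (fun r : R => (r%:C)%C : Cx R).
Proof.
move=> r; apply/cvgrPdist_lt => e e0.
have [eR eI] : 0 < complex.Re e /\ complex.Im e = 0.
  by move: e0; rewrite ltcE /= => /andP[/eqP -> ->].
have : \forall x \near r, `|r - x| < complex.Re e.
  by have /cvgrPdist_lt/(_ _ eR) := @cvg_id _ (nbhs r).
apply: filterS => x /= rx; rewrite -rmorphB /= normc_def /= expr0n /= addr0 sqrtr_sqr.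
by rewrite ltcE /= eI eqxx.
Qed.

Lemma hyp_set_sub (H : hyp W) v w : hyp_set H v -> hyp_set H w -> hyp_set H (v - w).
Proof.
have /hypP[s _ Hs] := ssvalP H; rewrite /hyp_set Hs /fixed_space /= => sv sw.
by rewrite mulmxBr sv sw.
Qed.

Lemma hyp_setZ (H : hyp W) c v : hyp_set H v -> hyp_set H (c *: v).
Proof.
have /hypP[s _ Hs] := ssvalP H; rewrite /hyp_set Hs /fixed_space /= => sv.
by rewrite -scalemxAr sv.
Qed.

(** Two distinct parameters giving points of [H] would put [x] in [H]: [x] is a linear combination
    of these two points, and [H] is a linear subspace. *)
Lemma line_meets_hyp_once (H : hyp W) (x y : 'cV[Cx R]_n) (z z' : Cx R) :
  ~ hyp_set H x -> hyp_set H (x + z *: (y - x)) -> hyp_set H (x + z' *: (y - x)) -> z = z'.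
Proof.
move=> Hx Hz Hz'; apply/eqP; rewrite -subr_eq0; apply/negPn/negP => zz'.
apply: Hx; move: (y - x) Hz Hz' => d Hz Hz'.
have -> : x = (z - z')^-1 *: (z *: (x + z' *: d) - z' *: (x + z *: d)).
  rewrite !(scalerDr z) !(scalerDr z') !scalerA opprD addrACA [z' * z]mulrC subrr addr0.
  by rewrite -scalerBl scalerA mulVf // scale1r.
by apply/hyp_setZ/hyp_set_sub; apply: hyp_setZ.
Qed.

(* On the complex line through x and y each hyperplane removes at most one point
   z, and t |-> t + i c t (1 - t) passes through z for at most one value of c. *)
Lemma complement_path_connected (x y : complement W) :
  inhabited {path I from x to y in complement W}.
Proof.
pose bad (H : hyp W) (z : Cx R) := hyp_set H (cval x + z *: (cval y - cval x)).
(* [zH H] is the only parameter at which the line can meet [H]; the value 0 is a placeholder when it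
   never does. *)
have /(_ _)/cid-/all_tag[zH zHP] : forall H, exists z0, forall z, bad H z -> z = z0.
  move=> H; have [[z0 Hz0]|nz] := pselect (exists z, bad H z); last first.
    by exists 0 => z Hz; case: nz; exists z.
  exists z0 => z Hz; apply: (line_meets_hyp_once _ Hz Hz0).
  by have /regularP := valP (x : {v | regular W v}); apply.
(* At an interior t, the curve [z] reaches [zH H] only for t = Re ([zH H]), which forces c to equal
   [cH H]; taking c larger than every [cH H] avoids all hyperplanes at once. The endpoints, where
   the denominator of [cH H] would vanish, are treated separately by the regularity of [x] and
   [y]. *)
pose cH H := complex.Im (zH H) / (complex.Re (zH H) * (1 - complex.Re (zH H))).
pose c := 1 + \sum_H `|cH H|.
have c_neq H : cH H != c.
  apply/eqP => cHc; have := ler_norm (cH H); rewrite {1}cHc /c (bigD1 H) //= => le.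
  have : 0 <= \sum_(i | i != H) `|cH i| by apply: sumr_ge0.
  by move: le; lra.
pose z (t : I) : Cx R := (ival t +i* (c * (ival t * (1 - ival t))))%C.
have reg t : regular W (cval x + z t *: (cval y - cval x)).
  apply/regularP => H Hz.
  have [t0|t0] := eqVneq (ival t) 0.
    have /regularP/(_ H) := valP (x : {v | regular W v}); apply.
    by move: Hz; rewrite /z t0 mul0r mulr0 scale0r addr0.
  have [t1|t1] := eqVneq (ival t) 1.
    have /regularP/(_ H) := valP (y : {v | regular W v}); apply.
    by move: Hz; rewrite /z t1 subrr mulr0 mulr0 scale1r addrC subrK.
  have := c_neq H; rewrite /cH -(zHP H _ Hz) /=.
  by rewrite mulfK ?eqxx // mulf_neq0 // subr_eq0 eq_sym.
pose f (t : I) : complement W := exist (regular W) _ (reg t).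
have zc : continuous z.
  (* Splitting off the factor i reduces the continuity of [z] to that of the embedding of the
     reals. *)
  have -> : z = fun t : I => ((ival t)%:C)%C + (0 +i* 1)%C * ((c * (ival t * (1 - ival t)))%:C)%C.
    by apply/funext => t; apply/eqP; rewrite eq_complex /=; apply/andP; split; apply/eqP; ring.
  have rc (g : I -> R) : continuous g -> continuous (fun t => ((g t)%:C)%C : Cx R).
    exact: (cont_comp real_complex_continuous).
  apply: continuous_addK; first exact/rc/ival_continuous.
  apply: continuous_mulK; first exact: cont_cst.
  apply: rc; apply: cont_mul; first exact: cont_cst.
  apply: cont_mul; first exact: ival_continuous.
  by apply: cont_sub; [exact: cont_cst|exact: ival_continuous].
have cf : continuous f.
  apply: continuous_comp_initial; apply: mx_continuous => i j.
  rewrite (_ : (fun _ => _) = fun t => cval x i j + z t * (cval y - cval x) i j); last first.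
    by apply/funext => t; rewrite /comp /= !mxE.
  apply: continuous_addK; first exact: cont_cst.
  by apply: (continuous_mulK zc); apply: cont_cst.
have f0 : f zero = x.
  by apply: cval_inj; rewrite /cval /= /z ival0 mul0r mulr0 scale0r addr0.
have f1 : f one = y.
  apply: cval_inj; rewrite /cval /= /z ival1 subrr mulr0 mulr0 scale1r.
  by rewrite addrC subrK.
by constructor; apply: path_of cf f0 f1.
Qed.

End PathConnected.

(** * Reversal and reassociation of concatenated paths *)

Section CatFun.
Context {R : realType} {T : topologicalType}.
Local Notation I := (unitI R).
Implicit Types f g h c : I -> T.

Lemma comp_cat_fun (U : topologicalType) (u : T -> U) f g :
  u \o cat_fun f g = cat_fun (u \o f) (u \o g).
Proof. by apply/funext => t; rewrite /cat_fun /=; case: ifP. Qed.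

Lemma cat_fun_irev f g : f one = g zero ->
  cat_fun f g \o irev = cat_fun (g \o irev) (f \o irev).
Proof.
move=> fg; apply/funext => t; rewrite /cat_fun /= ival_rev.
have /andP[t0 t1] := ivalP t; have [t2|t2|t2] := ltgtP (ival t) 2^-1.
- rewrite ifF; last by apply/negP; lra.
  congr g; apply: ival_inj; rewrite ival_rev !clampE ?ival_rev;
    by first [lra | apply/andP; split; lra].
- rewrite ifT; last by lra.
  congr f; apply: ival_inj; rewrite ival_rev !clampE ?ival_rev;
    by first [lra | apply/andP; split; lra].
(* At the midpoint both sides take their first branch, which gives [f one] on the left and [g zero]
   on the right. *)
- rewrite ifT; last by lra.
  rewrite half_fst; last by rewrite ival_rev; lra.
  by rewrite half_fst // irev1.
Qed.

(** Associativity up to homotopy. With [h] the reverse of [e], the right side is the conjugate by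
    [e] of the loop [f], [c], [g], while the left side is grouped in the way a braided reflection
    is. *)
Lemma cat_conj f g h c e : continuous f -> continuous g -> continuous h ->
    continuous c -> continuous e ->
    e one = f zero -> f one = c zero -> c one = g zero -> g one = h zero ->
  path_homotopic (cat_fun (cat_fun (cat_fun e f) c) (cat_fun g h))
                 (cat_fun (cat_fun e (cat_fun (cat_fun f c) g)) h).
Proof.
move=> cf cg ch cc ce ef fc cg1 gh.
have cef : continuous (cat_fun e f) by apply: cat_continuous.
have cfc : continuous (cat_fun f c) by apply: cat_continuous.
have cefc : continuous (cat_fun (cat_fun e f) c) by apply: cat_continuous; rewrite ?cat1.
apply: (path_homotopic_trans (cat_assoc cefc cg ch _ gh)); first by rewrite cat1.
apply: path_homotopic_cat; [by rewrite cat1| |exact: path_homotopic_refl].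
apply: (@path_homotopic_trans _ _ (cat_fun (cat_fun e (cat_fun f c)) g)).
  apply: path_homotopic_cat; [by rewrite cat1| |exact: path_homotopic_refl].
  by apply: path_homotopic_sym; apply: cat_assoc.
by apply: path_homotopic_sym; apply: cat_assoc; rewrite ?cat0 ?cat1.
Qed.

End CatFun.

(** * Conjugation of braided reflections by classes of paths *)

Section ConjugateBraidedReflection.
Context {R : realType} {n : nat} {W : reflection_group R n} (x0 : complement W).
Local Notation I := (unitI R).

Lemma orbit_proj_act w (v : complement W) : orbit_proj (act w v) = orbit_proj v.
Proof. by apply/esym/orbit_projP; exists w. Qed.

Lemma act_conjV (w s : W) (v : complement W) :
  act (w * s * w^-1)%g (act w v) = act w (act s v).
Proof. by rewrite -!actM -mulgA mulVg mulg1. Qed.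

Lemma distinguishedJ (H : hyp W) (s w : W) :
  distinguished H s -> distinguished (hyp_act w H) (w * s * w^-1)%g.
Proof.
case=> sH sv; split.
  move: sH; rewrite !inE => /asboolP sH; apply/asboolP => _ [u Hu <-].
  by rewrite !rg_mxM -!mulmxA (mulmxA (rg_mx W w^-1%g)) rg_mxVK mul1mx sH.
rewrite hyp_order_act; have /eigenvalueP[v vs v0] := sv.
(* [eigenvalue] refers to row vectors, so the eigenvector [v] of [s] is transported by right
   multiplication with the inverse of [w]. *)
apply/eigenvalueP; exists (v *m rg_mx W w^-1%g).
  by rewrite !rg_mxM !mulmxA -(mulmxA v) rg_mxVK mulmx1 vs scalemxAl.
by apply: contra_neq v0 => v0; rewrite -[v]mulmx1 -(rg_mxVK w) mulmxA v0 mul0mx.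
Qed.

(* If sigma is represented by gamma, c and the inverse of s(gamma), its conjugate
   is represented by beta w(gamma), w(c) and the inverse of (w s w^-1)(beta w(gamma)). *)
Lemma braided_reflectionJ (w : W) (beta : {path I from x0 to (act w x0) in complement W})
    (H : hyp W) (sigma : braid x0) :
  braided_reflection H sigma ->
  braided_reflection (hyp_act w H)
    (braid_class beta * sigma * (braid_class beta)^-1)%g.
Proof.
case=> s [y [gamma [c [p [u [ds [Hp su yE] disk cE ->]]]]]].
set s' := (w * s * w^-1)%g.
pose gamma' := path_cat beta (path_image (@act_continuous _ _ W w) gamma).
have cc' : continuous (act w \o c).
  by apply: cont_comp; [apply: act_continuous|apply: path_cont].
have c'0 : (act w \o c) zero = act w y by rewrite /= path_zero.
have c'1 : (act w \o c) one = act s' (act w y) by rewrite act_conjV /= path_one.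
pose c' := path_of cc' c'0 c'1.
exists s', (act w y), gamma', c', (rg_mx W w *m p), (rg_mx W w *m u).
split.
- exact: distinguishedJ.
- split; first by exists p.
    rewrite /s' !rg_mxM -!mulmxA (mulmxA (rg_mx W w^-1%g)) rg_mxVK mul1mx su.
    by rewrite hyp_order_act scalemxAr.
  by rewrite cval_act yE mulmxDr.
- move=> z H' z1 H'H Hz; apply: (disk z (hyp_act w^-1%g H') z1).
    apply: contra_neq H'H => <-; by rewrite -hyp_actM mulgV hyp_act1.
  exists (rg_mx W w *m p + z *: (rg_mx W w *m u)) => //.
  by rewrite scalemxAr -mulmxDr mulmxA rg_mxVK mul1mx.
- move=> t; rewrite hyp_order_act.
  transitivity (rg_mx W w *m cval (c t)); first reflexivity.
  by rewrite cE mulmxDr scalemxAr.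
rewrite -[(_^-1)%g]/(pi1_inv _) /braid_class pi1_invE -[(_ * _)%g]/(pi1_mul (pi1_mul _ _) _).
rewrite !pi1_mulE; apply/loop_class_eq.
set q := @orbit_proj R n W.
have cq : continuous q by exact: orbit_proj_continuous.
have cqb : continuous (q \o beta) by apply: cont_comp => //; apply: path_cont.
have cqg : continuous (q \o gamma) by apply: cont_comp => //; apply: path_cont.
have cqc : continuous (q \o c) by apply: cont_comp => //; apply: path_cont.
have cr (f : I -> orbit_space W) : continuous f -> continuous (f \o irev).
  by move=> cf; apply: cont_comp => //; apply: irev_continuous.
(* In the orbit space the translations by [w], [s] and [s'] become invisible: both loops turn into
   concatenations of the projections of [beta], [gamma], [c] and their reverses, grouped
   differently. *)
have qact (v : W) (f : I -> complement W) : q \o (act v \o f) = q \o f.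
  by apply/funext => t; rewrite /= /q orbit_proj_act.
have qb1 : (q \o beta) one = orbit_proj x0 by rewrite /= path_one /q orbit_proj_act.
have qb0 : (q \o beta) zero = orbit_proj x0 by rewrite /= path_zero.
have qg0 : (q \o gamma) zero = orbit_proj x0 by rewrite /= path_zero.
have qg1 : (q \o gamma) one = q y by rewrite /= path_one.
have qc0 : (q \o c) zero = q y by rewrite /= path_zero.
have qc1 : (q \o c) one = q y by rewrite /= path_one /q orbit_proj_act.
set P := path_cat (path_cat gamma c) _; set P' := path_cat (path_cat gamma' c') _.
apply: path_homotopic_sym.
change (path_homotopic (q \o P')
  (cat_fun (cat_fun (q \o beta) (q \o P)) ((q \o beta) \o irev))).
suff [-> ->] : q \o P' =
    cat_fun (cat_fun (cat_fun (q \o beta) (q \o gamma)) (q \o c))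
      (cat_fun ((q \o gamma) \o irev) ((q \o beta) \o irev)) /\
    q \o P = cat_fun (cat_fun (q \o gamma) (q \o c)) ((q \o gamma) \o irev).
  apply: cat_conj => //; try exact: cr.
  - by rewrite qb1 qg0.
  - by rewrite qg1 qc0.
  - by rewrite qc1 /= irev0 path_one.
  - by rewrite /= irev1 irev0 path_zero path_one /q orbit_proj_act.
split.
  transitivity (q \o cat_fun (cat_fun (cat_fun beta (act w \o gamma)) (act w \o c))
    ((act s' \o cat_fun beta (act w \o gamma)) \o irev)).
  by [].
  rewrite !(comp_cat_fun q) (qact w gamma) (qact w c); congr cat_fun.
  transitivity ((q \o (act s' \o cat_fun beta (act w \o gamma))) \o irev); first reflexivity.
  by rewrite qact comp_cat_fun qact cat_fun_irev ?qb1 ?qg0.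
transitivity (q \o cat_fun (cat_fun gamma c) ((act s \o gamma) \o irev)); first reflexivity.
rewrite !comp_cat_fun; congr cat_fun.
transitivity ((q \o (act s \o gamma)) \o irev); first reflexivity.
by rewrite qact.
Qed.

End ConjugateBraidedReflection.

(** * Moebius inversion and maps out of monoid algebras and quotients *)

Section MoebiusInversion.
Context {T : finType} {le : rel T} {A : zmodType}.
Hypotheses (le_refl : reflexive le) (le_anti : antisymmetric le) (le_trans : transitive le).

(** The size of the up-set is the measure for both inductions below, which go down from the maximal
    elements. *)
Lemma card_up x y : le x y -> x != y -> (#|le y| < #|le x|)%N.
Proof.
move=> xy nxy; apply/proper_card/properP; split.
  by apply/fintype.subsetP => z; apply: le_trans.
exists x; first by rewrite unfold_in.
by rewrite unfold_in; apply: contra nxy => yx; apply/eqP/le_anti; rewrite xy yx.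
Qed.

Lemma up_sum_eq0 (f : T -> A) : (forall x, \sum_(y | le x y) f y = 0) -> forall x, f x = 0.
Proof.
move=> f0 x; have [m] := ubnP #|le x|; elim: m x => // m IH x; rewrite ltnS => xm.
have := f0 x; rewrite (bigD1 x) //= big1 ?addr0 // => y /andP[xy yx].
by apply: IH; apply: leq_trans xm; apply: card_up; rewrite // eq_sym.
Qed.

(** The Moebius idempotents are known only through their up-sums, and identities between them are
    proved by this comparison. *)
Lemma up_sum_inj (f g : T -> A) :
  (forall x, \sum_(y | le x y) f y = \sum_(y | le x y) g y) -> f =1 g.
Proof.
move=> fg x; apply/eqP; rewrite -subr_eq0; apply/eqP.
by apply: (up_sum_eq0 (f := fun y => f y - g y)) => y; rewrite sumrB fg subrr.
Qed.

Lemma up_sum_surj (e : T -> A) : exists f, forall x, \sum_(y | le x y) f y = e x.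
Proof.
suff /(_ #|T|.+1)[f fP] : forall m, exists f : T -> A,
    forall x, (#|le x| < m)%N -> \sum_(y | le x y) f y = e x.
  by exists f => x; apply: fP; rewrite ltnS max_card.
elim=> [|m [f fP]]; first by exists (fun=> 0).
(* At level [m] the equation at [x] is solved for the value at [x], the values strictly above [x]
   being known already; elements with smaller up-sets keep their values. *)
exists (fun x => if (#|le x| < m)%N then f x else e x - \sum_(y | le x y && (y != x)) f y).
move=> x; rewrite ltnS leq_eqVlt => /orP[/eqP xm|xm]; last first.
  rewrite -fP //; apply: eq_bigr => y xy; rewrite ifT //.
  by have [<-//|nxy] := eqVneq x y; apply: ltn_trans xm; apply: card_up.
rewrite (bigD1 x) //= xm ltnn -[RHS](subrK (\sum_(y | le x y && (y != x)) f y)).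
congr (_ + _); apply: eq_bigr => y /andP[xy nyx].
by rewrite ifT // -xm; apply: card_up; rewrite // eq_sym.
Qed.

End MoebiusInversion.

(** * Extension of maps to monoid algebras and quotient rings *)

Section AdditiveMaps.
Context {U V : zmodType} (h : U -> V).
Hypothesis hD : {morph h : a b / a + b}.

Lemma morphD0 : h 0 = 0.
Proof. by apply: (addIr (h 0)); rewrite -hD !add0r. Qed.
Lemma morphDN a : h (- a) = - h a.
Proof. by apply: (addIr (h a)); rewrite -hD !addNr morphD0. Qed.
Lemma morphDB a b : h (a - b) = h a - h b.
Proof. by rewrite hD morphDN. Qed.
Lemma morphD_sum (I : Type) (r : seq I) (P : pred I) (F : I -> U) :
  h (\sum_(i <- r | P i) F i) = \sum_(i <- r | P i) h (F i).
Proof. exact: (big_morph h hD morphD0). Qed.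
End AdditiveMaps.

Section MonalgLift.
Context {A : pzRingType} {M : choiceType} {V : zmodType} (g : M -> A -> V).
Hypothesis gD : forall m, {morph g m : c d / c + d}.

(** The coefficient is an argument of [g], so that scalars may act through a ring morphism, or
    integers by multiples. *)
Definition monalg_lift (f : monalg A M) : V :=
  \sum_(m <- finsupp (mcoef f)) g m (mcoef f m).

Lemma monalg_liftE (d : {fset M}) f : (finsupp (mcoef f) `<=` d)%fset ->
  monalg_lift f = \sum_(m <- d) g m (mcoef f m).
Proof.
move=> fd; apply: big_fset_incl => // m _ mf.
by rewrite fsfun_dflt // morphD0.
Qed.

Lemma monalg_liftD : {morph monalg_lift : f h / f + h}.
Proof.
move=> f h; pose d := (finsupp (mcoef f) `|` finsupp (mcoef h) `|`
  finsupp (mcoef (f + h)%R))%fset.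
rewrite !(@monalg_liftE d); first last.
- by apply/fsubsetP => x xf; rewrite !in_fsetU xf ?orbT.
- by apply/fsubsetP => x xf; rewrite !in_fsetU xf ?orbT.
- by apply/fsubsetP => x xf; rewrite !in_fsetU xf ?orbT.
by rewrite -big_split; apply: eq_bigr => m _; rewrite [mcoef (_ + _) _]mcoefD gD.
Qed.

Lemma monalg_lift_single c m : monalg_lift (single c m) = g m c.
Proof.
rewrite (@monalg_liftE [fset m]%fset).
  by rewrite big_seq_fset1 mcoef_single eqxx.
apply/fsubsetP => x; rewrite mem_finsupp mcoef_single in_fset1.
by case: (x == m); rewrite ?eqxx.
Qed.
End MonalgLift.

Lemma monalg_liftM (A : pzRingType) (M : monoidType) (V : pzRingType) (g : M -> A -> V) :
    (forall m, {morph g m : c d / c + d}) ->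
    (forall m m' c c', g (m * m')%g (c * c') = g m c * g m' c') ->
  {morph monalg_lift g : f h / f * h}.
Proof.
move=> gD gM f h; have lD := monalg_liftD gD.
elim/(@monalg_ind A M): f => [|f f' IH IH'|c m].
- by rewrite mul0r (morphD0 lD) mul0r.
- by rewrite mulrDl !lD IH IH' mulrDl.
elim/(@monalg_ind A M): h => [|h h' IH IH'|d m'].
- by rewrite mulr0 (morphD0 lD) mulr0.
- by rewrite mulrDr !lD IH IH' mulrDr.
by rewrite singleM !monalg_lift_single // gM.
Qed.

Section QuotLift.
Context {A V : pzRingType} {S : set A} (h : A -> V).
Hypotheses (hD : {morph h : a b / a + b}) (hM : {morph h : a b / a * b}).
Hypothesis hS : forall a, S a -> h a = 0.

Definition quot_lift (x : quot S) : V := h (generic_quotient.repr x).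

(** The kernel of [h] is a two-sided ideal containing [S], so [h] does not see the choice of a
    representative. *)
Lemma quot_liftE a : quot_lift (cls S a) = h a.
Proof.
apply/eqP; rewrite -subr_eq0 -(morphDB hD); apply/eqP.
apply: (@reprB A S a [set b | h b = 0]); last by move=> b /hS.
split=> [|b c hb hc|b c d hc]; first exact: morphD0.
  by rewrite /= (morphDB hD) hb hc subrr.
by rewrite /= !hM hc mulr0 mul0r.
Qed.

Lemma quot_liftD : {morph quot_lift : x y / x + y}.
Proof.
by elim/(@quotW A S) => a; elim/(@quotW A S) => b; rewrite -rmorphD !quot_liftE hD.
Qed.

Lemma quot_liftM : {morph quot_lift : x y / x * y}.
Proof.
by elim/(@quotW A S) => a; elim/(@quotW A S) => b; rewrite -rmorphM !quot_liftE hM.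
Qed.
End QuotLift.

(** * Moebius idempotents of the lattice *)

Section LatticeIdempotents.
Context {R : realType} {n : nat} {W : reflection_group R n} {L : admissible_lattice W}.
Context {A : pzRingType} (e : lat L -> A).
Hypothesis eM : forall x y, e x * e y = e (lat_join x y).

Definition lat_le (x y : lat L) : bool := lat_group x \subset lat_group y.

Lemma lat_le_refl : reflexive lat_le.
Proof. by move=> x; apply: fintype.subxx. Qed.
Lemma lat_le_anti : antisymmetric lat_le.
Proof.
move=> x y /andP[xy yx]; apply/lat_inj/val_inj/eqP.
by rewrite finset.eqEsubset; apply/andP.
Qed.
Lemma lat_le_trans : transitive lat_le.
Proof. by move=> y x z; apply: fintype.subset_trans. Qed.

Variable eps : lat L -> A.
Hypothesis epsP : forall x, \sum_(y | lat_le x y) eps y = e x.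

(** Summed over the elements above [x], the left side becomes [e l * e x = e (lat_join l x)], the
    sum of the [eps y] with [y] above both [l] and [x]; the right side has the same sums. *)
Lemma lat_mul_eps l x : e l * eps x = if lat_le l x then eps x else 0.
Proof.
apply: (up_sum_inj lat_le_refl lat_le_anti lat_le_trans
  (f := fun x => e l * eps x) (g := fun x => if lat_le l x then eps x else 0)) => {}x.
rewrite -mulr_sumr epsP eM -epsP -big_mkcondr; apply: eq_bigl => y.
by rewrite /lat_le lat_joinP andbC.
Qed.

(** The same comparison in the first index: the up-sums of the left side are [e x * eps y], given by
    [lat_mul_eps]. *)
Lemma lat_eps_mul x y : eps x * eps y = if x == y then eps y else 0.
Proof.
apply: (up_sum_inj lat_le_refl lat_le_anti lat_le_trans
  (f := fun x => eps x * eps y) (g := fun x => if x == y then eps y else 0)) => {}x.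
rewrite -mulr_suml epsP lat_mul_eps -big_mkcondr; case: ifP => xy.
  rewrite (bigD1 y) ?xy ?eqxx //= big1 ?addr0 // => z /andP[/andP[_ /eqP ->]].
  by rewrite eqxx.
by rewrite big_pred0 // => z; have [->|] := eqVneq z y; rewrite ?xy ?andbF.
Qed.

End LatticeIdempotents.

(** Serves for sums indexed by ['I_(hyp_order H)]: the orders of H and w(H) are equal but not
    convertible. *)
Lemma eq_sum_ord (V : nmodType) (m m' : nat) (F : 'I_m -> V) (G : 'I_m' -> V) :
    m = m' -> (forall (i : 'I_m) (j : 'I_m'), i = j :> nat -> F i = G j) ->
  \sum_(i < m) F i = \sum_(i < m') G i.
Proof. by move=> mm'; case: m' / mm' G => G FG; apply: eq_bigr => i _; apply: FG. Qed.

Lemma mono_exp (A : pzRingType) (M : monoidType) (m : M) i :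
  mono m ^+ i = mono (m ^+ i)%g :> monalg A M.
Proof.
elim: i => [|i IH]; first by rewrite expr0 expg0.
by rewrite exprS IH expgS [LHS]singleM mulr1.
Qed.

Section HypIn.
Context {R : realType} {n : nat} {W : reflection_group R n}.

(** Fullness is what matters: one reflection of [x] with hyperplane [H] brings in all of them, and
    every non-trivial element of the pointwise stabilizer is such a reflection. *)
Lemma hyp_in_stab (L : admissible_lattice W) (H : hyp W) (x : lat L) :
  hyp_in H (lat_group x) <-> lat_le (lat_hyp L H) x.
Proof.
split=> [[t [tx rt tH]]|Hx]; last first.
  have /hypP[s rs Hs] := ssvalP H; exists s; split; rewrite ?Hs //.
  apply: (fintype.subsetP Hx); rewrite inE; apply/asboolP => v.
  by rewrite /hyp_set Hs.
apply/fintype.subsetP => s sH.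
have [->|[rs sfix]] := pointwise_stab_reflection rt tH sH; first exact: group1.
by have [_ H'] := al_full (lat_groupP x); apply: (H' t) => //; rewrite sfix tH.
Qed.

Lemma lat_act_hyp (L : admissible_lattice W) (H : hyp W) w :
  lat_act w (lat_hyp L H) = lat_hyp L (hyp_act w H).
Proof.
apply/lat_inj/val_inj/setP => s /=; rewrite mem_conjgV !inE.
apply/asboolP/asboolP => fs v Hv.
  have [u Hu <-] := Hv; have := fs u Hu; rewrite conjgE !rg_mxM -!mulmxA => su.
  by rewrite -[in RHS]su !mulmxA rg_mxKV mul1mx.
rewrite conjgE !rg_mxM -!mulmxA fs; last by exists v.
by rewrite mulmxA rg_mxVK mul1mx.
Qed.
End HypIn.

(** * The generalized Hecke algebras *)

Section BaseChangedPresentation.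
Context {S k : comPzRingType} (phi : {rmorphism S -> k}) {G : monoidType}.
Variable J : set (monalg S G).
Let H : algOver S := quot J.
Let Hk : algOver k := base_change phi H.
Let T (a : H) (c : k) : Hk := tensor phi a c.

Definition pres_elt (t : G) : Hk := T (cls J (mono t)) 1.

Lemma pres_eltM s t : pres_elt (s * t)%g = pres_elt s * pres_elt t.
Proof.
transitivity (T (cls J (mono s) * cls J (mono t)) (1 * 1)); last by rewrite [RHS]tensorM.
by rewrite mulr1 -rmorphM singleM mulr1.
Qed.

Lemma pres_elt1 : pres_elt 1%g = 1.
Proof. exact: (alg_of1 (s := Hk)). Qed.

Lemma pres_eltX t i : pres_elt (t ^+ i)%g = pres_elt t ^+ i.
Proof.
elim: i => [|i IH]; first by rewrite expg0 expr0 pres_elt1.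
by rewrite expgS exprS pres_eltM IH.
Qed.

Lemma tensor0 c : T 0 c = 0.
Proof. by apply: (addIr (T 0 c)); rewrite -[LHS]tensorDl !add0r. Qed.

Lemma tensor_sum (I : Type) (r : seq I) (F : I -> H) c :
  T (\sum_(i <- r) F i) c = \sum_(i <- r) T (F i) c.
Proof. by apply: (big_morph (T^~ c)) => [a b|]; [apply: tensorDl|apply: tensor0]. Qed.

(** The coefficient [r] crosses the tensor sign by [tensorZ] and arrives in [k] as [phi r]. *)
Lemma tensor_cls_single r t c :
  T (cls J (single r t)) c = alg_of (phi r * c) * pres_elt t.
Proof.
transitivity (T 1 (phi r * c) * T (cls J (mono t)) 1); last by [].
rewrite [RHS]tensorM mulr1 mul1r -tensorZ; congr (T _ c).
by rewrite -[alg_of r]/(cls J (single r 1%g)) -rmorphM singleM mulr1 mul1g.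
Qed.

Lemma pres_ind (P : Hk -> Prop) :
    P 0 -> (forall x y, P x -> P y -> P (x + y)) -> (forall x, P x -> P (- x)) ->
    (forall c t, P (alg_of c * pres_elt t)) ->
  forall z, P z.
Proof.
move=> P0 PD PN P1; elim/(@base_change_ind _ _ phi H) => // a c.
elim/(@quotW _ J): a; elim/(@monalg_ind S G) => [|f g Pf Pg|r t].
- by rewrite rmorph0 -[tensor _ _ _]/(T 0 c) tensor0.
- have TD : T (cls J (f + g)) c = T (cls J f) c + T (cls J g) c.
    by rewrite rmorphD; apply: tensorDl.
  by rewrite -[tensor _ _ _]/(T (cls J (f + g)) c) TD; refine (PD _ _ Pf Pg).
by rewrite -[tensor _ _ _]/(T _ c) tensor_cls_single.
Qed.

Lemma pres_elt_root m (t : G) (r : 'I_m -> S) :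
    J (mono t ^+ m - \sum_(i < m) alg_of (r i) * mono t ^+ i) ->
  pres_elt t ^+ m = \sum_(i < m) alg_of (phi (r i)) * pres_elt t ^+ i.
Proof.
move=> Jt; rewrite -pres_eltX /pres_elt -mono_exp (cls_eq (ideal_gen_sub Jt)).
rewrite rmorph_sum tensor_sum; apply: eq_bigr => i _; rewrite -pres_eltX mono_exp.
rewrite -[alg_of (r i)]/(single (r i) 1%g) singleM mulr1 mul1g.
by rewrite tensor_cls_single mulr1.
Qed.

Lemma pres_elt_eq1 (t : G) : J (mono t - 1) -> pres_elt t = 1.
Proof. by move=> Jt; rewrite -pres_elt1 /pres_elt (cls_eq (ideal_gen_sub Jt)). Qed.

(* B need not be compatible with the relations: only its product with the
   idempotent E is, and the induced map is a morphism sending 1 to E. *)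
Lemma pres_lift (V : algOver k) (B : G -> V) (E : V) :
    (forall s t, B (s * t)%g = B s * B t) -> (forall t, E * B t = B t * E) -> E * E = E ->
    (forall z, J z -> monalg_lift (fun t r => alg_of (phi r) * B t * E) z = 0) ->
  exists psi : Hk -> V, {morph psi : x y / x + y} /\
    forall c t, psi (alg_of c * pres_elt t) = alg_of c * B t * E.
Proof.
move=> BM EB EE J0.
have gD t : {morph (fun r => alg_of (phi r) * B t * E) : c d / c + d}.
  by move=> c d; rewrite rmorphD alg_ofD !mulrDl.
pose h0 := monalg_lift (fun t r => alg_of (phi r) * B t * E).
have h0D : {morph h0 : f g / f + g} by apply: monalg_liftD gD.
have h0M : {morph h0 : f g / f * g}.
  apply: monalg_liftM gD _ => s t c d.
  (* Because [E] commutes with every [B t] and is idempotent, the [E] of a left factor is absorbed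
     by the right one; this makes [h0] multiplicative. *)
  have EV : E * (alg_of (phi d) * B t * E) = alg_of (phi d) * B t * E.
    by rewrite !mulrA -alg_ofC -(mulrA _ E) EB -!mulrA EE.
  rewrite -[RHS]mulrA EV rmorphM alg_ofM BM !mulrA.
  by rewrite -(mulrA (alg_of (phi c)) (B s) (alg_of _)) -(alg_ofC _ (B s)) !mulrA.
have [h1 [h1D h1M h1E]] : exists h1 : H -> V, [/\ {morph h1 : a b / a + b},
    {morph h1 : a b / a * b} & forall f, h1 (cls J f) = h0 f].
  exists (quot_lift (S := J) h0).
  by split; [apply: quot_liftD|apply: quot_liftM|apply: quot_liftE].
have h1s s a : h1 (alg_of s * a) = alg_of (phi s) * h1 a.
  elim/(@quotW _ J): a => f; rewrite -[alg_of s]/(cls J (single s 1%g)) -rmorphM !h1E.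
  elim/(@monalg_ind S G): f => [|f g Pf Pg|r t].
  - by rewrite mulr0 (morphD0 h0D) mulr0.
  - by rewrite mulrDr !h0D mulrDr Pf Pg.
  by rewrite singleM mul1g /h0 !monalg_lift_single // rmorphM alg_ofM !mulrA.
have h1t t : h1 (cls J (mono t)) = B t * E.
  by rewrite h1E /h0 monalg_lift_single // rmorph1 alg_of1 mul1r.
move: h1 h1D h1M h1s h1t {h1E} => h1 h1D h1M h1s h1t.
(* The base change is a quotient of the ring Z[H x k]. There the pair (a, c) is sent to c times
   [h1 a], integers act by multiples, and the bilinearity relations go to 0. *)
have [h2 [h2D h2M h2E]] : exists h2 : monalg int (tensor_pair H k) -> V,
    [/\ {morph h2 : f g / f + g}, {morph h2 : f g / f * g} &
       forall a c, h2 (mono ((a, c) : tensor_pair H k)) = alg_of c * h1 a].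
  pose g2 (p : tensor_pair H k) (z : int) := alg_of p.2 * h1 p.1 *~ z.
  have g2D p : {morph g2 p : c d / c + d} by move=> c d; rewrite /g2 mulrzDr.
  exists (monalg_lift g2); split=> [||a c]; first exact: monalg_liftD.
    apply: monalg_liftM g2D _ => p q c d; rewrite /g2 /= h1M alg_ofM.
    rewrite mulrzAl mulrzAr -mulrzA (mulrC d); congr (_ *~ _).
    by rewrite -!mulrA (mulrA (h1 p.1)) -alg_ofC !mulrA.
  by rewrite monalg_lift_single.
have h2B f g : h2 (f - g) = h2 f - h2 g by apply: morphDB.
have h2J z : tensor_rel phi z -> h2 z = 0.
  pose m a c : monalg int (tensor_pair H k) := mono ((a, c) : tensor_pair H k).
  case=> [[[a [b [c zE]]]|[a [c [d zE]]]]|[s [a [c zE]]]].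
  - have {zE}-> : z = m (a + b) c - m a c - m b c := zE.
    transitivity (alg_of c * h1 (a + b) - alg_of c * h1 a - alg_of c * h1 b).
      by rewrite -!h2E -h2B -[RHS]h2B.
    by rewrite h1D mulrDr -addrA -opprD subrr.
  - have {zE}-> : z = m a (c + d) - m a c - m a d := zE.
    transitivity (alg_of (c + d) * h1 a - alg_of c * h1 a - alg_of d * h1 a).
      by rewrite -!h2E -h2B -[RHS]h2B.
    by rewrite alg_ofD mulrDl -addrA -opprD subrr.
  have {zE}-> : z = m (alg_of s * a) c - m a (phi s * c) := zE.
  transitivity (alg_of c * h1 (alg_of s * a) - alg_of (phi s * c) * h1 a).
    by rewrite -!h2E -h2B.
  by rewrite h1s mulrA -alg_ofM (mulrC c) subrr.
have h3 z : quot_lift (S := tensor_rel phi (A := H)) h2 (cls _ z) = h2 z by apply: quot_liftE.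
exists (quot_lift (S := tensor_rel phi (A := H)) h2); split; first exact: quot_liftD.
move=> c t; have -> : alg_of c * pres_elt t = T (cls J (mono t)) c.
  transitivity (T 1 c * T (cls J (mono t)) 1); first by [].
  by rewrite [LHS]tensorM mulr1 mul1r.
by rewrite [LHS]h3 h2E h1t mulrA.
Qed.

End BaseChangedPresentation.

Section HeckePresentation.
Context {R : realType} {n : nat} {W : reflection_group R n} {x0 : complement W}.
Variables (pi : natural_projection x0) (L : admissible_lattice W).
Variables (k : comPzRingType) (phi : {rmorphism laurent W -> k}) (x : lat L).
Local Notation hat := (in_hatB pi x).

(* k H~_x together with the canonical map of hat(B)_x into it, which entry extends
   to B by an arbitrary value. *)
Record hecke_presentation (K : algOver k) (entry : braid x0 -> K) : Prop := HeckePresentation {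
  presentation_one : entry 1%g = 1;
  presentation_mul : forall b c, b \in hat -> c \in hat ->
    entry (b * c)%g = entry b * entry c;
  presentation_root : forall H b, hyp_in H (lat_group x) -> braided_reflection H b ->
    entry b ^+ hyp_order H = \sum_(i < hyp_order H) alg_of (phi (a_ i)) * entry b ^+ i;
  presentation_eq1 : forall H b, ~ hyp_in H (lat_group x) -> braided_reflection H b ->
    entry (b ^+ hyp_order H)%g = 1;
  presentation_ind : forall P : K -> Prop,
    P 0 -> (forall y z, P y -> P z -> P (y + z)) -> (forall y, P y -> P (- y)) ->
    (forall c b, b \in hat -> P (alg_of c * entry b)) -> forall z, P z;
  presentation_lift : forall (V : algOver k) (B : braid x0 -> V) (E : V),
    (forall b c, B (b * c)%g = B b * B c) -> B 1%g = 1 ->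
    (forall b, b \in hat -> E * B b = B b * E) -> E * E = E ->
    (forall H b, hyp_in H (lat_group x) -> braided_reflection H b ->
       B (b ^+ hyp_order H)%g * E =
       \sum_(i < hyp_order H) alg_of (phi (a_ i)) * B (b ^+ i)%g * E) ->
    (forall H b, ~ hyp_in H (lat_group x) -> braided_reflection H b ->
       B (b ^+ hyp_order H)%g * E = E) ->
    exists psi : K -> V, {morph psi : y z / y + z} /\
      forall c b, b \in hat -> psi (alg_of c * entry b) = alg_of c * B b * E
}.
End HeckePresentation.

(** * The isomorphism *)

Section Orbits.
Context {R : realType} {n : nat} {W : reflection_group R n} {L : admissible_lattice W}.
Implicit Types (x y : lat L) (X : lat_orbits L).

Lemma lat_act_inj w : injective (@lat_act _ _ _ L w).
Proof. by move=> x y /(congr1 (lat_act w^-1)); rewrite -!lat_actM mulVg !lat_act1. Qed.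

Lemma lat_act_le w x y : lat_le (lat_act w x) (lat_act w y) = lat_le x y.
Proof. by rewrite /lat_le lat_act_sub -lat_actM mulVg lat_act1. Qed.

Lemma lat_le_join x y z : lat_le (lat_join x y) z = lat_le x z && lat_le y z.
Proof. exact: lat_joinP. Qed.

Lemma lat_orbit_subproof x : lat_orbit x \in [set lat_orbit y | y : lat L]%SET.
Proof. exact: imset_f. Qed.
Definition orbit_of x : lat_orbits L := exist _ (lat_orbit x) (lat_orbit_subproof x).

Lemma mem_orbit_of x : x \in val (orbit_of x).
Proof. by apply/imsetP; exists 1%g; rewrite ?lat_act1. Qed.

Lemma orbit_trans X x y : x \in val X -> y \in val X -> exists w, y = lat_act w x.
Proof.
have /imsetP[z _ ->] := valP X => /imsetP[w _ ->] /imsetP[w' _ ->].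
by exists (w' * w^-1)%g; rewrite -lat_actM -mulgA mulVg mulg1.
Qed.

Lemma orbit_act X x w : x \in val X -> lat_act w x \in val X.
Proof.
have /imsetP[z _ ->] := valP X => /imsetP[w' _ ->].
by rewrite -lat_actM; apply: imset_f.
Qed.

Lemma orbit_of_eq X x : x \in val X -> orbit_of x = X.
Proof.
move=> xX; apply: val_inj; apply/setP => y; apply/imsetP/idP => [[w _ ->]|yX].
  exact: orbit_act.
by have [w ->] := orbit_trans xX yX; exists w.
Qed.

(** Matrices are indexed by ordinals; [pt X] turns a row or column index into the point of the orbit
    that it stands for. *)
Definition pt X (i : 'I_#|val X|) : lat L := enum_val i.
Arguments pt : clear implicits.

Lemma ptP X i : pt X i \in val X.
Proof. exact: enum_valP. Qed.

Lemma pt_inj X : injective (pt X).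
Proof. exact: enum_val_inj. Qed.

Lemma pt_ex X x : x \in val X -> exists i, pt X i = x.
Proof. by move=> xX; exists (enum_rank_in xX x); apply: enum_rankK_in. Qed.

Lemma pt_orbit_neq X X' i i' : X != X' -> pt X i != pt X' i'.
Proof.
apply: contra_neq => ii'; rewrite -(orbit_of_eq (ptP i)) ii'; exact: orbit_of_eq (ptP i').
Qed.

(** The orbits partition the lattice, so the indices of all blocks together enumerate it once. *)
Lemma sum_pt (V : nmodType) (F : lat L -> V) :
  \sum_X \sum_i F (pt X i) = \sum_y F y.
Proof.
rewrite [RHS](partition_big orbit_of xpredT) //=; apply: eq_bigr => X _.
transitivity (\sum_(y in val X) F y).
  by apply: esym; apply: (big_enum_val (A := mem (val X))).
apply: eq_bigl => y.
apply/idP/eqP => [|<-]; first exact: orbit_of_eq.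
exact: mem_orbit_of.
Qed.

Lemma sum_pt_eq (V : nmodType) X x (a : V) : x \in val X ->
  \sum_i (if x == pt X i then a else 0) = a.
Proof.
move=> /pt_ex[i <-]; rewrite (bigD1 i) //= eqxx big1 ?addr0 // => j ji.
by rewrite (inj_eq (@pt_inj X)) eq_sym (negPf ji).
Qed.
End Orbits.
Arguments pt {R n W L} X i.

(** Carries the shape of the defining relation of C through a map of algebras; that 1 is preserved
    comes from the scalar 1. It serves for the matrix representations and for the class map onto
    C. *)
Lemma rel_morph (k : comPzRingType) (A B : algOver k) (f : A -> B) :
    {morph f : a b / a + b} -> {morph f : a b / a * b} ->
    (forall c, f (alg_of c) = alg_of c) ->
  forall (s l : A) (s' l' : B) m (c : 'I_m -> k), f s = s' -> f l = l' ->
  f (s ^+ m - 1 - (\sum_(i < m) alg_of (c i) * s ^+ i - 1) * l) =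
  s' ^+ m - 1 - (\sum_(i < m) alg_of (c i) * s' ^+ i - 1) * l'.
Proof.
move=> fD fM falg s l _ _ m c <- <-; have fB := morphDB fD.
have f1 : f 1 = 1 by rewrite -!alg_of1.
have fX i : f (s ^+ i) = f s ^+ i.
  by elim: i => [|i IH]; rewrite ?expr0 // !exprS fM IH.
rewrite !fB fM fB f1 fX (morphD_sum fD); congr (_ - (_ - _) * _).
by apply: eq_bigr => i _; rewrite fM falg fX.
Qed.

Lemma alg_mxE (k : comPzRingType) (A : algOver k) m c (M : 'M[A]_m) i j :
  (alg_of c * M) i j = alg_of c * M i j.
Proof. by rewrite [alg_of c * M]mul_scalar_mx mxE. Qed.

(** * The matrix representation attached to an orbit *)

Section Isomorphism.
Context {R : realType} {n : nat} {W : reflection_group R n} {x0 : complement W}.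
Variables (pi : natural_projection x0) (L : admissible_lattice W).
Variables (k : comPzRingType) (phi : {rmorphism laurent W -> k}).
Variable rep : lat_orbits L -> lat L.
Variable u : lat L -> braid x0.
Hypothesis u_rep : forall (X : lat_orbits L) y, y \in val X -> lat_act (pi (u y)) y = rep X.
Hypothesis uJ : forall y H sigma, braided_reflection H sigma ->
  braided_reflection (hyp_act (pi (u y)) H) (u y * sigma * (u y)^-1)%g.

Variables (K : lat_orbits L -> algOver k) (entry : forall X, braid x0 -> K X).
Hypothesis KP : forall X, hecke_presentation pi phi (rep X) (@entry X).
Local Notation hat X := (in_hatB pi (rep X)).
Let entry1 X := presentation_one (KP X).
Let entryM X := presentation_mul (KP X).
Implicit Types X : lat_orbits L.

(* The monoid structure of L x B depends on pi, which its carrier does not determine. *)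
Local Notation LB := (@Defs_skew_monoid__canonical__monoid_Monoid R n W x0 pi L).
Local Notation kBL := (monalg k LB).

(** When pi(b) y = z, with [y] and [z] in one orbit, this transports [b] to an element stabilizing
    the representative, where [entry] is meaningful. *)
Definition conj_u (z y : lat L) (b : braid x0) : braid x0 := (u z * b * (u y)^-1)%g.

Lemma conj_uM z l y b c : conj_u z y (b * c)%g = (conj_u z l b * conj_u l y c)%g.
Proof. by rewrite /conj_u !mulgA mulgKV. Qed.

Lemma conj_uX y b i : conj_u y y (b ^+ i)%g = (conj_u y y b ^+ i)%g.
Proof.
elim: i => [|i IH]; first by rewrite !expg0 /conj_u mulg1 mulgV.
by rewrite !expgS -IH; apply: conj_uM.
Qed.

Lemma u_inv (X : lat_orbits L) y : y \in val X -> lat_act (pi (u y))^-1 (rep X) = y.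
Proof. by move=> yX; rewrite -(u_rep yX) -lat_actM mulVg lat_act1. Qed.

Lemma conj_u_in (X : lat_orbits L) z y b : y \in val X -> z \in val X -> lat_act (pi b) y = z ->
  conj_u z y b \in in_hatB pi (rep X).
Proof.
move=> yX zX byz; rewrite unfold_in !gmulfM !lat_actM npV (u_inv yX) byz.
by rewrite (u_rep zX).
Qed.

Definition skew_pair (l : lat L) (b : braid x0) : LB := (l, b).

(** The pair (l, b) stands for e_l b. Here b moves the idempotent of y to that of pi(b) y, which e_l
    keeps if l lies below pi(b) y and kills otherwise; hence the test of [p.1] against the row. *)
Definition skew_mx X (p : LB) : 'M[K X]_#|val X| :=
  \matrix_(i, j) if (lat_act (pi p.2) (pt X j) == pt X i) && lat_le p.1 (pt X i)
                 then entry X (conj_u (pt X i) (pt X j) p.2) else 0.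

Lemma skew_mx1 X : skew_mx X (1%g : LB) = 1.
Proof.
apply/matrixP => i j; rewrite !mxE /= np1 lat_act1 (inj_eq (@pt_inj _ _ _ _ X)) eq_sym.
rewrite /lat_le sub1G andbT; case: eqP => // ->.
by rewrite /conj_u mulg1 mulgV entry1.
Qed.

(** Column [j] of the matrix of (m, c) can be non-zero only in the row of pi(c) ([pt X j]), so one
    term of the product survives. The order conditions match because pi(b) preserves the order and a
    join lies below a point exactly when both arguments do. *)
Lemma skew_mxM X (p q : LB) : skew_mx X (p * q)%g = skew_mx X p * skew_mx X q.
Proof.
case: p q => [l b] [m c]; apply/matrixP => i j; rewrite [RHS]mxE mxE /=.
have [h hE] := pt_ex (orbit_act (pi c) (ptP j)).
rewrite (bigD1 h) //= big1 ?addr0 => [|h' h'h]; last first.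
  by rewrite [skew_mx X (m, c) _ _]mxE /= -hE (inj_eq (@pt_inj _ _ _ _ X)) eq_sym
    (negPf h'h) mulr0.
rewrite !mxE /= hE eqxx /= gmulfM lat_actM lat_le_join.
have [bi|nbi] /= := eqVneq; last by rewrite mul0r.
rewrite -bi lat_act_le; case: ifP => [/andP[-> ->]|].
  rewrite (conj_uM _ (lat_act (pi c) (pt X j))) entryM //.
    by apply: conj_u_in => //; [rewrite -hE; apply: ptP|rewrite bi; apply: ptP].
  by apply: conj_u_in => //; [apply: ptP|rewrite -hE; apply: ptP].
case: (lat_le l _) => /= [->|_]; first by rewrite mulr0.
by rewrite mul0r.
Qed.

Definition skew_lift X : kBL -> 'M[K X]_#|val X| :=
  monalg_lift (fun p c => alg_of c * skew_mx X p).

Lemma skew_liftD X : {morph @skew_lift X : f g / f + g}.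
Proof. by apply: monalg_liftD => p c d; rewrite alg_ofD mulrDl. Qed.

Lemma skew_lift_single X c p : skew_lift X (single c p) = alg_of c * skew_mx X p.
Proof. by apply: monalg_lift_single => {}p {}c d; rewrite alg_ofD mulrDl. Qed.

Lemma skew_lift_mono X p : skew_lift X (mono p) = skew_mx X p.
Proof. by rewrite skew_lift_single alg_of1 mul1r. Qed.

Lemma skew_liftM X : {morph @skew_lift X : f g / f * g}.
Proof.
apply: monalg_liftM => [p c d|p q c d]; first by rewrite alg_ofD mulrDl.
rewrite skew_mxM alg_ofM -!mulrA; congr (_ * _).
by rewrite !mulrA (alg_ofC d).
Qed.

Lemma skew_lift_alg X c : skew_lift X (alg_of c) = alg_of c.
Proof. by rewrite [LHS]skew_lift_single skew_mx1 mulr1. Qed.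

Lemma skew_mulE l b m c :
  (skew_pair l b * skew_pair m c)%g = skew_pair (lat_join l (lat_act (pi b) m)) (b * c)%g.
Proof. by []. Qed.

Lemma skew_mxX X (b : braid x0) m :
  skew_mx X (skew_pair (lat_one L) b) ^+ m = skew_mx X (skew_pair (lat_one L) (b ^+ m)%g).
Proof.
elim: m => [|m IH]; first by rewrite expr0 expg0 -skew_mx1.
by rewrite exprS IH -skew_mxM skew_mulE lat_act_one lat_join1l expgS.
Qed.

Lemma skew_mx_lat X l i j :
  skew_mx X (skew_pair l 1%g) i j = if (j == i) && lat_le l (pt X j) then 1 else 0.
Proof.
rewrite mxE /= np1 lat_act1 (inj_eq (@pt_inj _ _ _ _ X)).
by case: eqP => //= ->; rewrite /conj_u mulg1 mulgV entry1.
Qed.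

Lemma skew_mx_braid X (b : braid x0) i j :
  skew_mx X (skew_pair (lat_one L) b) i j =
  if lat_act (pi b) (pt X j) == pt X i then entry X (conj_u (pt X i) (pt X j) b) else 0.
Proof. by rewrite mxE /= /lat_le sub1G andbT. Qed.

Lemma hat_exp X b i : b \in hat X -> (b ^+ i)%g \in hat X.
Proof.
rewrite !unfold_in npX => /eqP bX; apply/eqP.
by elim: i => [|i IH]; rewrite ?expg0 ?lat_act1 // expgS lat_actM IH.
Qed.

Lemma entryX X b i : b \in hat X -> entry X (b ^+ i)%g = entry X b ^+ i.
Proof.
move=> bX; elim: i => [|i IH]; first by rewrite expg0 expr0 entry1.
by rewrite expgS exprS entryM ?IH ?hat_exp.
Qed.

Lemma braided_fix H sigma (y : lat L) :
  braided_reflection H sigma -> lat_le (lat_hyp L H) y -> lat_act (pi sigma) y = y.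
Proof.
move=> /(np_braided pi)[sH _] /fintype.subsetP Hy.
by apply/lat_inj/val_inj; rewrite /= conjGid // groupV Hy.
Qed.

Lemma braided_exp_fix H sigma (y : lat L) i :
  braided_reflection H sigma -> lat_le (lat_hyp L H) y ->
  lat_act (pi (sigma ^+ i)%g) y = y.
Proof.
move=> sH Hy; rewrite npX; elim: i => [|i IH]; first by rewrite expg0 lat_act1.
by rewrite expgS lat_actM IH (braided_fix sH).
Qed.

Lemma braided_exp_pi H sigma :
  braided_reflection H sigma -> pi (sigma ^+ hyp_order H)%g = 1%g.
Proof.
move=> /(np_braided pi)[sH _].
by rewrite npX (expg_cardG (G := pointwise_stab_group H) sH).
Qed.

Lemma hyp_in_rep X H y : y \in val X ->
  hyp_in (hyp_act (pi (u y)) H) (lat_group (rep X)) <-> lat_le (lat_hyp L H) y.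
Proof.
by move=> yX; rewrite hyp_in_stab -lat_act_hyp -(u_rep yX) lat_act_le.
Qed.

(** By [uJ] the conjugate of [sigma] by [u y] is a braided reflection around the image of [H], a
    hyperplane of the same order that is not in [rep X] because [H] is not in [y]. *)
Lemma entry_conj_eq1 X H sigma y : y \in val X -> braided_reflection H sigma ->
  ~~ lat_le (lat_hyp L H) y -> entry X (conj_u y y (sigma ^+ hyp_order H)%g) = 1.
Proof.
move=> yX sH Hy; rewrite conj_uX -(hyp_order_act H (pi (u y))).
by apply: (presentation_eq1 (KP X)); [rewrite hyp_in_rep //; apply/negP|apply: uJ].
Qed.

Lemma entry_conj_root X H sigma y : y \in val X -> braided_reflection H sigma ->
  lat_le (lat_hyp L H) y ->
  entry X (conj_u y y (sigma ^+ hyp_order H)%g) =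
  \sum_(i < hyp_order H) alg_of (phi (a_ i)) * entry X (conj_u y y (sigma ^+ i)%g).
Proof.
move=> yX sH Hy; have sX : conj_u y y sigma \in hat X.
  by apply: conj_u_in => //; apply: braided_fix sH Hy.
rewrite conj_uX entryX // -[in LHS](hyp_order_act H (pi (u y))).
rewrite (presentation_root (KP X) (H := hyp_act (pi (u y)) H)); first last.
- exact: uJ.
- exact/hyp_in_rep.
(* Orders and parameters are constant on W-orbits of hyperplanes, so the relation for the image of
   [H] is the one written with [H]. *)
apply: eq_sum_ord => [|i j ij]; first exact: (hyp_order_act H (pi (u y))).
by rewrite conj_uX entryX // -ij (a_conj (i := j) (j := i)).
Qed.

(** Checked column by column. If H lies in [pt X j], then e_H preserves the column, sigma fixes the
    point and [entry_conj_root] gives the relation. Otherwise e_H kills the column, and sigma^m,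
    diagonal because its image in W is 1, has diagonal entry 1 by [entry_conj_eq1]. *)
Lemma skew_lift_rel X z : C_rel pi phi z -> skew_lift X z = 0.
Proof.
case=> H [s [sH ->]].
rewrite [LHS](rel_morph (A := kBL) (B := 'M[K X]_#|val X|) (@skew_liftD X) (@skew_liftM X)
  (@skew_lift_alg X) (fun i => phi (a_ i))
  (skew_lift_mono X (skew_pair (lat_one L) s)) (skew_lift_mono X (skew_pair (lat_hyp L H) 1%g))).
rewrite skew_mxX; under eq_bigr do rewrite skew_mxX.
set Q := \sum_(_ < _) _.
set P := skew_mx X _.
have QE i j : ((Q - 1) * skew_mx X (skew_pair (lat_hyp L H) 1%g)) i j =
    if lat_le (lat_hyp L H) (pt X j) then Q i j - 1%:M i j else 0.
  rewrite mxE (bigD1 j) //= skew_mx_lat eqxx /= big1 ?addr0 => [|l lj].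
    by rewrite !mxE; case: ifP => _; rewrite ?mulr1 ?mulr0.
  by rewrite skew_mx_lat eq_sym (negPf lj) mulr0.
have PE i j : P i j = if j == i then entry X (conj_u (pt X j) (pt X j) (s ^+ hyp_order H)%g) else 0.
  rewrite skew_mx_braid (braided_exp_pi sH) lat_act1 (inj_eq (@pt_inj _ _ _ _ X)).
  by case: eqP => // ->.
have QiE i j : lat_le (lat_hyp L H) (pt X j) -> Q i j = P i j.
  move=> Hy; rewrite PE /Q summxE; have [ji|ji] := eqVneq j i.
    rewrite (entry_conj_root (ptP _) sH) //; apply: eq_bigr => l _.
    by rewrite alg_mxE skew_mx_braid (braided_exp_fix _ sH Hy) ji eqxx.
  rewrite big1 // => l _; rewrite alg_mxE skew_mx_braid.
  by rewrite (braided_exp_fix _ sH Hy) (inj_eq (@pt_inj _ _ _ _ X)) (negPf ji) mulr0.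
apply/matrixP => i j; rewrite [RHS]mxE [LHS]mxE [X in _ + X]mxE QE [X in X - _]mxE.
have [Hy|Hy] := boolP (lat_le _ _).
  by rewrite QiE // [X in _ + X - _]mxE subrr.
rewrite PE [X in _ + X - _]mxE mxE subr0 eq_sym; case: eqVneq => [_|_]; last by rewrite subrr.
by rewrite (entry_conj_eq1 (ptP _) sH) // subrr.
Qed.
End Isomorphism.

Lemma alg_isomorphicP (k : comPzRingType) (A B : algOver k) (f : A -> B) (g : B -> A) :
    {morph f : a b / a + b} -> {morph f : a b / a * b} ->
    (forall c, f (alg_of c) = alg_of c) -> cancel f g -> cancel g f ->
  alg_isomorphic A B.
Proof.
move=> fD fM falg fK gK.
have f1 : f 1 = 1 by rewrite -!alg_of1.
pose F : {rmorphism A -> B} := HB.pack f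
  (GRing.isZmodMorphism.Build A B f (morphDB fD))
  (GRing.isMonoidMorphism.Build A B f (conj f1 fM)).
by exists F; split; first exact: Bijective fK gK.
Qed.

(** * The inverse of the matrix representation *)

Section Inverse.
Context {R : realType} {n : nat} {W : reflection_group R n} {x0 : complement W}.
Variables (pi : natural_projection x0) (L : admissible_lattice W).
Variables (k : comPzRingType) (phi : {rmorphism laurent W -> k}).
Variable rep : lat_orbits L -> lat L.
Variable u : lat L -> braid x0.
Implicit Types X : lat_orbits L.
Hypothesis u_rep : forall X y, y \in val X -> lat_act (pi (u y)) y = rep X.
Variables (K : lat_orbits L -> algOver k) (entry : forall X, braid x0 -> K X).
Local Notation hat X := (in_hatB pi (rep X)).
Hypothesis KP : forall X, hecke_presentation pi phi (rep X) (@entry X).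

(* A stands for C, with BC b and EC l the classes of b and e_l. *)
Variables (A : algOver k) (BC : braid x0 -> A) (EC : lat L -> A).
Hypothesis BCM : forall b c, BC (b * c)%g = BC b * BC c.
Hypothesis BC1 : BC 1%g = 1.
Hypothesis ECM : forall l m, EC l * EC m = EC (lat_join l m).
Hypothesis EC1 : EC (lat_one L) = 1.
Hypothesis BC_EC : forall b l, BC b * EC l = EC (lat_act (pi b) l) * BC b.
Hypothesis A_ind : forall (P : A -> Prop),
  P 0 -> (forall x y, P x -> P y -> P (x + y)) ->
  (forall c l b, P (alg_of c * EC l * BC b)) -> forall z, P z.
Hypothesis A_rel : forall H b, braided_reflection H b ->
  BC (b ^+ hyp_order H)%g - 1 =
  (\sum_(i < hyp_order H) alg_of (phi (a_ i)) * BC (b ^+ i)%g - 1) * EC (lat_hyp L H).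
Variable F : forall X, A -> 'M[K X]_#|val X|.
Hypothesis FD : forall X, {morph @F X : a b / a + b}.
Hypothesis FM : forall X, {morph @F X : a b / a * b}.
Hypothesis FE : forall X c l b i j, F X (alg_of c * EC l * BC b) i j =
  if (lat_act (pi b) (pt X j) == pt X i) && lat_le l (pt X i)
  then alg_of c * entry X (conj_u u (pt X i) (pt X j) b) else 0.

Variable eps : lat L -> A.
Hypothesis epsP : forall x, \sum_(y | lat_le x y) eps y = EC x.

Lemma BCV b : BC b^-1%g * BC b = 1.
Proof. by rewrite -BCM mulVg BC1. Qed.

(** Conjugation by [b] sends e_y to e_(pi(b) y) and preserves the order, and the idempotents are
    determined by their up-sums. *)
Lemma BC_eps b y : BC b * eps y = eps (lat_act (pi b) y) * BC b.
Proof.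
suff -> : eps y = BC b^-1%g * eps (lat_act (pi b) y) * BC b.
  by rewrite !mulrA -BCM mulgV BC1 mul1r.
apply: (up_sum_inj (@lat_le_refl _ _ _ L) (@lat_le_anti _ _ _ L) (@lat_le_trans _ _ _ L)
  (f := eps) (g := fun y => BC b^-1%g * eps (lat_act (pi b) y) * BC b)) => {}y.
rewrite -mulr_suml -mulr_sumr epsP.
have -> : \sum_(z | lat_le y z) eps (lat_act (pi b) z) = EC (lat_act (pi b) y).
  rewrite -epsP [RHS](reindex_inj (@lat_act_inj _ _ _ L (pi b))) /=.
  by apply: eq_bigl => z; rewrite lat_act_le.
by rewrite -mulrA -BC_EC mulrA BCV mul1r.
Qed.

Lemma psi_exists X : exists psi : K X -> A, {morph psi : x y / x + y} /\
  forall c b, b \in hat X -> psi (alg_of c * entry X b) = alg_of c * BC b * eps (rep X).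
Proof.
have Eeps := lat_mul_eps ECM epsP.
apply: (presentation_lift (KP X)) => //.
- by move=> b /eqP bX; rewrite BC_eps bX.
- by rewrite (lat_eps_mul ECM epsP) eqxx.
(* Here e_H fixes the idempotent, so the two subtracted copies of it cancel and the Hecke relation
   remains. *)
- move=> H b /hyp_in_stab Hx bH; have := congr1 (fun a => a * eps (rep X)) (A_rel bH).
  rewrite /= -[RHS]mulrA Eeps Hx !mulrBl mul1r => /addIr ->.
  by rewrite mulr_suml.
(* Here e_H kills the idempotent, and with it the whole right side of the relation of C. *)
move=> H b Hx bH; apply/eqP; rewrite -subr_eq0 -[X in _ - X]mul1r -mulrBl A_rel //.
by rewrite -mulrA Eeps; case: ifP => [/hyp_in_stab//|]; rewrite mulr0.
Qed.

(** The image of e_y is diagonal, with 1 exactly at the points above [y]; this is the up-sum of the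
    diagonal matrix units. *)
Lemma F_eps X y i j : F X (eps y) i j = if (i == j) && (pt X j == y) then 1 else 0.
Proof.
pose g y : 'M[K X]_#|val X| := \matrix_(i, j) if (i == j) && (pt X j == y) then 1 else 0.
suff -> : F X (eps y) = g y by rewrite mxE.
apply: (up_sum_inj (@lat_le_refl _ _ _ L) (@lat_le_anti _ _ _ L) (@lat_le_trans _ _ _ L)
  (f := fun y => F X (eps y)) (g := g)) => {i j}y.
rewrite -(morphD_sum (@FD X)) epsP; apply/matrixP => i j.
have -> : EC y = alg_of 1 * EC y * BC 1%g by rewrite alg_of1 mul1r BC1 mulr1.
rewrite FE np1 lat_act1 (inj_eq (@pt_inj _ _ _ _ X)) summxE.
under eq_bigr do rewrite mxE.
have [<-|ji] := eqVneq j i; last first.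
  by rewrite big1 // => z _; rewrite eq_sym (negPf ji).
rewrite /= alg_of1 mul1r /conj_u mulg1 mulgV (presentation_one (KP X)).
have [yj|yj] := boolP (lat_le _ _).
  rewrite (bigD1 (pt X j)) //= eqxx big1 ?addr0 // => z /andP[_ zj].
  by rewrite eq_sym (negPf zj).
by rewrite big1 // => z yz; case: eqP => // jz; rewrite jz yz in yj.
Qed.

Variable psi : forall X, K X -> A.
Hypothesis psiD : forall X, {morph @psi X : x y / x + y}.
Hypothesis psiE : forall X c b, b \in hat X ->
  psi (alg_of c * entry X b) = alg_of c * BC b * eps (rep X).

(** A matrix with the single entry h at (i, j) goes to u_i^-1 psi(h) u_j, an element of the Peirce
    component between the idempotents of the points i and j. *)
Definition mx_unlift (f : forall X, 'M[K X]_#|val X|) : A :=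
  \sum_X \sum_j \sum_i
    BC (u (pt X i))^-1%g * psi (f X i j) * BC (u (pt X j)).

Lemma unlift_entry X c b i j : b \in hat X ->
  BC (u (pt X i))^-1%g * psi (alg_of c * entry X b) * BC (u (pt X j)) =
  alg_of c * BC ((u (pt X i))^-1 * b * u (pt X j))%g * eps (pt X j).
Proof.
move=> bX; rewrite psiE // -!mulrA.
have -> : eps (rep X) * BC (u (pt X j)) = BC (u (pt X j)) * eps (pt X j).
  by rewrite BC_eps (u_rep (ptP j)).
by rewrite !mulrA -alg_ofC !BCM !mulrA.
Qed.

(** On c e_l b the entries give the sum of the c b eps_y over all y with l below pi(b) y. This
    condition says that pi(b)^-1 l lies below y, so the sum is c b e_(pi(b)^-1 l) = c e_l b. *)
Lemma F_unlift : cancel (fun a X => F X a) mx_unlift.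
Proof.
have mxD : {morph mx_unlift \o (fun a X => F X a) : a b / a + b}.
  move=> a b; rewrite /= /mx_unlift -big_split; apply: eq_bigr => Y _ /=.
  rewrite -big_split; apply: eq_bigr => j _ /=; rewrite -big_split; apply: eq_bigr => i _ /=.
  by rewrite FD mxE psiD mulrDr mulrDl.
move=> a; elim/A_ind: a => [|a b IHa IHb|c l b].
- exact: (morphD0 mxD).
- by rewrite [LHS]mxD /= IHa IHb.
transitivity (\sum_y if lat_le l (lat_act (pi b) y) then alg_of c * BC b * eps y else 0).
  rewrite -sum_pt /mx_unlift; apply: eq_bigr => Y _; apply: eq_bigr => j _.
  rewrite -[RHS](sum_pt_eq _ (orbit_act (pi b) (ptP j))); apply: eq_bigr => i _.
  rewrite FE; have [bj /=|_] := eqVneq; last by rewrite (morphD0 (@psiD Y)) mulr0 mul0r.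
  rewrite -bj; case: ifP => _; last by rewrite (morphD0 (@psiD Y)) mulr0 mul0r.
  rewrite bj unlift_entry; last by apply: conj_u_in bj; rewrite ?ptP.
  by rewrite /conj_u !mulgA mulVg mul1g mulgKV.
rewrite -big_mkcond -mulr_sumr.
under eq_bigl => y do rewrite -{1}[l](lat_act1) -(mulgV (pi b)) lat_actM lat_act_le.
by rewrite epsP -!mulrA BC_EC -lat_actM mulgV lat_act1.
Qed.

Lemma F_mul_eps X a y i j : F X (a * eps y) i j = if pt X j == y then F X a i j else 0.
Proof.
rewrite FM mxE (bigD1 j) //= F_eps eqxx /= big1 ?addr0 => [|l lj].
  by case: eqP; rewrite ?mulr1 ?mulr0.
by rewrite F_eps (negPf lj) mulr0.
Qed.

(** The idempotent on the right selects the column of [pt Y j'], and the element of B in front moves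
    that point to [pt Y i'], which selects the row. *)
Lemma F_unlift_entry X Y i j i' j' c b : b \in hat Y ->
  F X (BC (u (pt Y i'))^-1%g * psi (alg_of c * entry Y b) * BC (u (pt Y j'))) i j =
  if pt X j == pt Y j'
  then if pt Y i' == pt X i
       then alg_of c * entry X (conj_u u (pt X i) (pt X j) ((u (pt Y i'))^-1 * b * u (pt Y j'))%g)
       else 0
  else 0.
Proof.
move=> bY; rewrite unlift_entry // F_mul_eps; case: eqP => // jj'.
have -> (d : braid x0) : alg_of c * BC d = alg_of c * EC (lat_one L) * BC d.
  by rewrite EC1 mulr1.
rewrite FE /lat_le sub1G andbT jj'.
rewrite !gmulfM npV !lat_actM (u_rep (ptP j')) (eqP bY).
by rewrite (u_inv u_rep (ptP i')).
Qed.

(** By additivity [h] may be taken to be a scalar times an [entry]; the column condition then fails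
    since distinct orbits are disjoint. *)
Lemma unlift_entry_neq X Y i j i' j' (h : K Y) : X != Y ->
  F X (BC (u (pt Y i'))^-1%g * psi h * BC (u (pt Y j'))) i j = 0.
Proof.
move=> XY; have GD : {morph (fun h : K Y =>
    F X (BC (u (pt Y i'))^-1%g * psi h * BC (u (pt Y j'))) i j) : a b / a + b}.
  by move=> a b; rewrite psiD mulrDr mulrDl FD mxE.
elim/(presentation_ind (KP Y)): h => [|a b IHa IHb|a IHa|c b bY].
- exact: (morphD0 GD).
- by rewrite [LHS]GD IHa IHb addr0.
- by rewrite [LHS](morphDN GD) IHa oppr0.
by rewrite F_unlift_entry // (negPf (pt_orbit_neq _ _ XY)).
Qed.

Lemma unlift_entry_eq X i j i' j' (h : K X) :
  F X (BC (u (pt X i'))^-1%g * psi h * BC (u (pt X j'))) i j =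
  if j == j' then if i' == i then h else 0 else 0.
Proof.
have GD : {morph (fun h : K X =>
    F X (BC (u (pt X i'))^-1%g * psi h * BC (u (pt X j'))) i j) : a b / a + b}.
  by move=> a b; rewrite psiD mulrDr mulrDl FD mxE.
elim/(presentation_ind (KP X)): h => [|a b IHa IHb|a IHa|c b bY].
- by rewrite [LHS](morphD0 GD) !if_same.
- by rewrite [LHS]GD IHa IHb; do 2![case: ifP => _; rewrite ?addr0 //].
- by rewrite [LHS](morphDN GD) IHa; do 2![case: ifP => _; rewrite ?oppr0 //].
rewrite F_unlift_entry // !(inj_eq (@pt_inj _ _ _ _ X)).
case: eqP => // ->; case: eqP => // ->.
(* The conjugators of [conj_u] cancel those put in by [mx_unlift]. *)
by rewrite /conj_u !mulgA mulgV mul1g mulgK.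
Qed.

Lemma unliftK : cancel mx_unlift (fun a X => F X a).
Proof.
move=> f; apply: functional_extensionality_dep => X; apply/matrixP => i j.
rewrite /mx_unlift (morphD_sum (@FD X)) (bigD1 X) //=.
rewrite [Z in _ + Z]big1 ?addr0 => [|Y YX]; last first.
  rewrite (morphD_sum (@FD X)) big1 // => j' _; rewrite (morphD_sum (@FD X)) big1 // => i' _.
  by apply/matrixP => i1 j1; rewrite unlift_entry_neq 1?eq_sym // mxE.
rewrite (morphD_sum (@FD X)) summxE (bigD1 j) //= [Z in _ + Z]big1 ?addr0 => [|j' jj'].
  rewrite (morphD_sum (@FD X)) summxE (bigD1 i) //= [Z in _ + Z]big1 ?addr0 => [|i' ii'].
    by rewrite unlift_entry_eq !eqxx.
  by rewrite unlift_entry_eq (negPf ii') if_same.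
rewrite (morphD_sum (@FD X)) summxE big1 // => i' _.
by rewrite unlift_entry_eq eq_sym (negPf jj').
Qed.

End Inverse.

Lemma conjugators_exist (R : realType) (n : nat) (W : reflection_group R n)
    (x0 : complement W) (pi : natural_projection x0) (L : admissible_lattice W)
    (rep : lat_orbits L -> lat L) : (forall X : lat_orbits L, rep X \in val X) ->
  exists u : lat L -> braid x0,
    (forall (X : lat_orbits L) y, y \in val X -> lat_act (pi (u y)) y = rep X) /\
    (forall y H sigma, braided_reflection H sigma ->
       braided_reflection (hyp_act (pi (u y)) H) (u y * sigma * (u y)^-1)%g).
Proof.
move=> rep_in.
suff /(_ _)/cid-/all_tag[u uP] : forall y : lat L, exists b : braid x0,
    lat_act (pi b) y = rep (orbit_of y) /\
    forall H sigma, braided_reflection H sigma ->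
      braided_reflection (hyp_act (pi b) H) (b * sigma * b^-1)%g.
  exists u; split=> [X y yX|y]; last by have [] := uP y.
  by have [-> _] := uP y; rewrite (orbit_of_eq yX).
move=> y; have [w ->] := orbit_trans (mem_orbit_of y) (rep_in (orbit_of y)).
have [beta] := complement_path_connected x0 (act w x0).
exists (braid_class beta); rewrite np_path; split=> // H sigma.
exact: braided_reflectionJ.
Qed.

(** * The generalized Hecke algebras satisfy the abstract presentation *)

Section LiftRelations.
Context {S k : comPzRingType} (phi : {rmorphism S -> k}) {G : monoidType}.
Context {V : algOver k} (B : G -> V) (E : V).
Let g (t : G) (r : S) := alg_of (phi r) * B t * E.

Lemma monalg_lift_root m (t : G) (r : 'I_m -> S) :
  monalg_lift g (mono t ^+ m - \sum_(i < m) alg_of (r i) * mono t ^+ i) =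
  B (t ^+ m)%g * E - \sum_(i < m) alg_of (phi (r i)) * B (t ^+ i)%g * E.
Proof.
have gD s : {morph g s : c d / c + d} by move=> c d; rewrite /g rmorphD alg_ofD !mulrDl.
have lD := monalg_liftD gD; rewrite (morphDB lD) (morphD_sum lD) mono_exp.
rewrite monalg_lift_single // /g rmorph1 alg_of1 mul1r; congr (_ - _).
apply: eq_bigr => i _; rewrite mono_exp -[alg_of (r i)]/(single (r i) 1%g) singleM mulr1 mul1g.
by rewrite monalg_lift_single.
Qed.

Lemma monalg_lift_sub1 (t : G) :
  monalg_lift g (mono t - 1) = B t * E - B 1%g * E.
Proof.
have gD s : {morph g s : c d / c + d} by move=> c d; rewrite /g rmorphD alg_ofD !mulrDl.
have lD := monalg_liftD gD; rewrite (morphDB lD).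
by rewrite !monalg_lift_single // /g rmorph1 alg_of1 !mul1r.
Qed.
End LiftRelations.

Section HeckeIsPresented.
Context {R : realType} {n : nat} {W : reflection_group R n} {x0 : complement W}.
Variables (pi : natural_projection x0) (L : admissible_lattice W).
Variables (k : comPzRingType) (phi : {rmorphism laurent W -> k}) (x : lat L).
Local Notation hat := (in_hatB pi x).

(** [insubd] replaces an element outside the preimage of the stabilizer by 1, so that matrix entries
    carry no membership proofs. *)
Definition hecke_entry (b : braid x0) : hecke_base_change pi x phi :=
  pres_elt (laurent_sub_map phi) (@hecke_rel _ _ _ _ pi L x) (insubd 1%g b).

Lemma hatB_insubd (b : braid x0) : b \in hat -> hatB_val (insubd (1%g : hatB pi x) b) = b.
Proof. exact: insubdK. Qed.

Lemma hecke_entryE (t : hatB pi x) :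
  hecke_entry (hatB_val t) = pres_elt (laurent_sub_map phi) (@hecke_rel _ _ _ _ pi L x) t.
Proof. by rewrite /hecke_entry valKd. Qed.

Lemma hatB_valX (t : hatB pi x) i : hatB_val (t ^+ i)%g = (hatB_val t ^+ i)%g.
Proof. by elim: i => [|i IH] //; rewrite !expgS -IH. Qed.

Lemma hecke_presented : hecke_presentation pi phi x hecke_entry.
Proof.
split.
- by rewrite -[1%g]/(hatB_val (1%g : hatB pi x)) hecke_entryE; apply: pres_elt1.
- move=> b c bX cX; rewrite -(hatB_insubd bX) -(hatB_insubd cX).
  set s := insubd _ _; set t := insubd _ _.
  by rewrite -[(_ * _)%g]/(hatB_val (s * t)%g) !hecke_entryE; apply: pres_eltM.
- move=> H b Hx bH; have bX := braided_in_hatB pi Hx bH.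
  rewrite -(hatB_insubd bX) in bH *; set t := insubd _ _ in bH *; rewrite hecke_entryE.
  apply: (@pres_elt_root _ _ (laurent_sub_map phi) _ _ _ t (fun i => a_in Hx i)).
  by left; exists H, Hx, t.
- move=> H b Hx bH; have bX := braided_pow_in_hatB pi x bH.
  rewrite -(hatB_insubd bX) hecke_entryE; apply: pres_elt_eq1.
  by right; exists H, b, (insubd 1%g (b ^+ hyp_order H)%g); split=> //; apply: hatB_insubd.
- move=> P P0 PD PN P1; apply: pres_ind => // c t.
  rewrite -hecke_entryE; apply: P1; exact: valP.
move=> V B E BM B1 EB EE Broot Bunip.
have [||||psi [psiD psiE]] := @pres_lift _ _ (laurent_sub_map phi) _ (@hecke_rel _ _ _ _ pi L x) V
  (fun t => B (hatB_val t)) E.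
- by move=> s t; rewrite -BM.
- by move=> t; apply: EB; apply: valP.
- exact: EE.
- move=> z [[H [Hx [t [tH ->]]]]|[H [b [t [Hx bH tE ->]]]]].
    rewrite monalg_lift_root hatB_valX (Broot H) //.
    by under [in X in _ - X]eq_bigr do rewrite hatB_valX; rewrite subrr.
  by rewrite monalg_lift_sub1 tE (Bunip H) // B1 mul1r subrr.
exists psi; split=> // c b bX.
by rewrite -(hatB_insubd bX) hecke_entryE psiE.
Qed.
End HeckeIsPresented.

(** * The algebra C and the assembly of the isomorphism *)

Section CElements.
Context {R : realType} {n : nat} {W : reflection_group R n} {x0 : complement W}.
Variables (pi : natural_projection x0) (L : admissible_lattice W).
Variables (k : comPzRingType) (phi : {rmorphism laurent W -> k}).
Local Notation LB := (@Defs_skew_monoid__canonical__monoid_Monoid R n W x0 pi L).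
Local Notation kBL := (monalg k LB).
Local Notation C := (C_algebra pi L phi).

Definition C_braid (b : braid x0) : C := cls (C_rel pi phi) (of_braid pi L k b).
Definition C_lat (l : lat L) : C := cls (C_rel pi phi) (of_lat pi k l).

Lemma of_braidM b c : of_braid pi L k (b * c)%g = (of_braid pi L k b : kBL) * of_braid pi L k c.
Proof. by rewrite [RHS]singleM mulr1 skew_mulE lat_act_one lat_join1l. Qed.

Lemma of_latM l m : of_lat pi k (lat_join l m) = (of_lat pi k l : kBL) * of_lat pi k m.
Proof. by rewrite [RHS]singleM mulr1 skew_mulE np1 lat_act1 mulg1. Qed.

Lemma of_lat_braid c l b :
  single c (skew_pair pi l b) = alg_of c * (of_lat pi k l : kBL) * of_braid pi L k b.
Proof.
rewrite -[alg_of c]/(single c (1%g : LB)) !singleM !mulr1 mul1g skew_mulE.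
by rewrite np1 lat_act1 lat_join1r mul1g.
Qed.

Lemma C_braidM b c : C_braid (b * c)%g = C_braid b * C_braid c.
Proof. by rewrite /C_braid of_braidM; apply: rmorphM. Qed.

Lemma C_braid1 : C_braid 1%g = 1.
Proof. exact: (rmorph1 (cls (C_rel pi phi))). Qed.

Lemma C_latM l m : C_lat l * C_lat m = C_lat (lat_join l m).
Proof. by rewrite /C_lat of_latM; apply/esym; apply: rmorphM. Qed.

Lemma C_lat1 : C_lat (lat_one L) = 1.
Proof. exact: (rmorph1 (cls (C_rel pi phi))). Qed.

Lemma C_braid_lat b l : C_braid b * C_lat l = C_lat (lat_act (pi b) l) * C_braid b.
Proof.
transitivity (cls (C_rel pi phi) ((of_braid pi L k b : kBL) * of_lat pi k l)).
  by apply/esym; apply: rmorphM.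
by rewrite of_braid_lat; apply: rmorphM.
Qed.

Lemma cls_single c l b :
  cls (C_rel pi phi) (single c (skew_pair pi l b)) = alg_of c * C_lat l * C_braid b.
Proof.
rewrite of_lat_braid.
transitivity (cls (C_rel pi phi) (alg_of c * (of_lat pi k l : kBL)) * C_braid b).
  exact: rmorphM.
by congr (_ * _); apply: rmorphM.
Qed.

Lemma C_ind (P : C -> Prop) : P 0 -> (forall x y, P x -> P y -> P (x + y)) ->
    (forall c l b, P (alg_of c * C_lat l * C_braid b)) ->
  forall z, P z.
Proof.
move=> P0 PD P1; elim/(@quotW kBL (C_rel pi phi)).
elim/(@monalg_ind k LB) => [|f g Pf Pg|c [l b]].
- exact: P0.
- have -> : cls (C_rel pi phi) (f + g) = cls (C_rel pi phi) f + cls (C_rel pi phi) g.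
    exact: rmorphD.
  exact: (PD _ _ Pf Pg).
by rewrite -[(l, b)]/(skew_pair pi l b) cls_single; apply: P1.
Qed.

Lemma C_relE H b : braided_reflection H b ->
  C_braid (b ^+ hyp_order H)%g - 1 =
  (\sum_(i < hyp_order H) alg_of (phi (a_ i)) * C_braid (b ^+ i)%g - 1) * C_lat (lat_hyp L H).
Proof.
move=> bH; apply/eqP; rewrite -subr_eq0; apply/eqP.
have CX i : C_braid (b ^+ i)%g = C_braid b ^+ i.
  by elim: i => [|i IH]; rewrite ?expg0 ?expr0 ?C_braid1 // expgS exprS C_braidM IH.
rewrite CX; under eq_bigr do rewrite CX.
have clsD : {morph (cls (C_rel pi phi) : kBL -> C) : f g / f + g} by move=> f g; apply: rmorphD.
have clsM : {morph (cls (C_rel pi phi) : kBL -> C) : f g / f * g} by move=> f g; apply: rmorphM.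
(* By [rel_morph] the difference of the two sides is the class of a generator of the ideal. *)
rewrite -[LHS](@rel_morph k kBL C (cls (C_rel pi phi)) clsD clsM (fun=> erefl)
  (of_braid pi L k b) (of_lat pi k (lat_hyp L H)) (C_braid b) (C_lat (lat_hyp L H))
  (hyp_order H) (fun i => phi (a_ i)) erefl erefl).
rewrite -[RHS](morphD0 clsD); apply: cls_eq; rewrite subr0; apply: ideal_gen_sub.
by exists H, b.
Qed.

Variable rep : lat_orbits L -> lat L.
Variable u : lat L -> braid x0.
Hypothesis u_rep : forall (X : lat_orbits L) y, y \in val X -> lat_act (pi (u y)) y = rep X.
Hypothesis uJ : forall y H sigma, braided_reflection H sigma ->
  braided_reflection (hyp_act (pi (u y)) H) (u y * sigma * (u y)^-1)%g.
Variables (K : lat_orbits L -> algOver k) (entry : forall X, braid x0 -> K X).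
Hypothesis KP : forall X, hecke_presentation pi phi (rep X) (@entry X).

Definition C_map (X : lat_orbits L) : C -> 'M[K X]_#|val X| :=
  quot_lift (S := C_rel pi phi) (skew_lift u entry X).

Lemma C_mapD X : {morph @C_map X : a b / a + b}.
Proof.
exact: (quot_liftD (@skew_liftD _ _ _ _ pi L k u K entry X) (skew_liftM u_rep KP X)
  (skew_lift_rel u_rep uJ KP X)).
Qed.

Lemma C_mapM X : {morph @C_map X : a b / a * b}.
Proof.
exact: (quot_liftM (@skew_liftD _ _ _ _ pi L k u K entry X) (skew_liftM u_rep KP X)
  (skew_lift_rel u_rep uJ KP X)).
Qed.

Lemma C_map_cls X a : C_map X (cls (C_rel pi phi) a) = skew_lift u entry X a.
Proof.
exact: (quot_liftE (@skew_liftD _ _ _ _ pi L k u K entry X) (skew_liftM u_rep KP X)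
  (skew_lift_rel u_rep uJ KP X)).
Qed.

Lemma C_mapE X c l b i j : C_map X (alg_of c * C_lat l * C_braid b) i j =
  if (lat_act (pi b) (pt X j) == pt X i) && lat_le l (pt X i)
  then alg_of c * entry X (conj_u u (pt X i) (pt X j) b) else 0.
Proof.
rewrite -cls_single C_map_cls skew_lift_single alg_mxE mxE.
by case: ifP => _; rewrite ?mulr0.
Qed.

Lemma C_algebra_isomorphic :
  alg_isomorphic C (dsum (fun X : lat_orbits L => 'M[K X]_#|val X|)).
Proof.
(* Moebius inversion is applied inside C, to the classes of the e_l. *)
have [eps epsP] := up_sum_surj (@lat_le_refl _ _ _ L) (@lat_le_anti _ _ _ L)
  (@lat_le_trans _ _ _ L) C_lat.
have /(_ _)/cid-/all_tag[psi psiP] :=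
  psi_exists KP C_braidM C_braid1 C_latM C_braid_lat C_relE epsP.
have psiD X := (psiP X).1; have psiE X := (psiP X).2.
apply: (@alg_isomorphicP k C (dsum (fun X : lat_orbits L => 'M[K X]_#|val X|))
  (fun a X => C_map X a) (mx_unlift u C_braid psi)).
- by move=> a b; apply: dsumP => X; apply: C_mapD.
- by move=> a b; apply: dsumP => X; apply: C_mapM.
- move=> c; apply: dsumP => X; rewrite C_map_cls; exact: skew_lift_alg.
- exact: (F_unlift u_rep C_braidM C_braid1 C_braid_lat C_ind C_mapD C_mapE epsP psiD psiE).
exact: (unliftK u_rep KP C_braidM C_braid1 C_lat1 C_braid_lat C_mapD C_mapM C_mapE epsP
  psiD psiE).
Qed.
End CElements.

Theorem theorem1p2 (R : realType) (n : nat) (W : reflection_group R n)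
    (x0 : complement W) (pi : natural_projection x0) (L : admissible_lattice W)
    (k : comPzRingType) (phi : {rmorphism laurent W -> k})
    (rep : lat_orbits L -> lat L)
    (rep_in : forall X : lat_orbits L, rep X \in val X) :
  alg_isomorphic (C_algebra pi L phi)
    (dsum (fun X : lat_orbits L => 'M[hecke_base_change pi (rep X) phi]_#|val X|)).
Proof.
have [u [u_rep uJ]] := conjugators_exist pi rep_in.
exact: (C_algebra_isomorphic u_rep uJ (fun X => hecke_presented pi phi (rep X))).
Qed.
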